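(* Let $X$ be a path-connected Hausdorff space with basepoint $e$ such that the inclusion $\{e\}\to X$ is a cofibration. Then there is a unique homomorphism $\rho:H_1(X)\to\pi_1(J(X),e)$ satisfying $\rho\circ h_X=\sigma_\#$, and $\rho$ is an isomorphism. In particular $\pi_1(J(X),e)\cong H_1(X)$.
   Context: $h_X:\pi_1(X,e)\to H_1(X)$ is the Hurewicz homomorphism and $H_1$ is singular homology. The James reduced product of a based space $(X,e)$ is $J(X)=\coprod_{n\in\mathbb{N}}X^n/\sim$ where $\sim$ is generated by $(x_1,\dots,x_{j-1},e,x_{j+1},\dots,x_n)\sim(x_1,\dots,x_{j-1},x_{j+1},\dots,x_n)$; elements are finite words in $X\setminus\{e\}$ with word concatenation as operation. Topology: $X^n$ has the product topology, $J_n(X)$ (words of length $\leq n$) has the quotient topology from $q_n:X^n\to J_n(X)$, and $J(X)$ has the weak topology with respect to $\{J_n(X)\}$. $\sigma:X\to J(X)$ is the inclusion of one-letter words and $\sigma_\#$ the induced homomorphism on $\pi_1$. *)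

(* Defs.v *)
From HB Require Import structures.
From mathcomp Require Import all_boot all_order all_algebra generic_quotient.
From mathcomp Require Import all_classical all_reals topology normedtype.
Import numFieldNormedType.Exports.

Set Implicit Arguments.
Unset Strict Implicit.
Unset Printing Implicit Defensive.
Import Order.TTheory GRing.Theory Num.Theory.
Local Open Scope classical_set_scope.
Local Open Scope ring_scope.
Local Open Scope quotient_scope.

(** * Quotient of a subset [P] of [T] by a relation [r], as the set of
    classes [{y | P y /\ r x y}] with [P x].  When [r] is an equivalence
    relation on [P] (as is the case below), this is the usual quotient set.
    [cls] sends an element to its class (elements outside [P] are sent to
    the class of the fixed default [x0]); [rep] picks a representative.   *)
Definition quot_of {T : Type} (P : set T) (r : T -> T -> Prop) : Type :=
  {A : set T | exists2 x, P x & A = [set y | P y /\ r x y]}.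

Section Quot.
Context {T : Type} (P : set T) (r : T -> T -> Prop) (x0 : T) (Px0 : P x0).

Definition fix_elt (x : T) : T := if `[< P x >] then x else x0.

Lemma fix_eltP x : P (fix_elt x).
Proof. by rewrite /fix_elt; case: (asboolP (P x)). Qed.

Definition cls (x : T) : quot_of P r :=
  exist _ [set y | P y /\ r (fix_elt x) y]
    (ex_intro2 _ _ (fix_elt x) (fix_eltP x) erefl).

Definition rep (A : quot_of P r) : T := projT1 (cid2 (proj2_sig A)).
End Quot.

Section Simplices.
Context (R : realType).

(** The standard 1-simplex [0,1] and 2-simplex
    {(s,t) | 0 <= s, 0 <= t, s + t <= 1} (vertices (0,0),(1,0),(0,1)),
    with the subspace topology. *)
Definition Delta1_set : set R := [set t | 0 <= t <= 1].
Definition Delta2_set : set (R * R) :=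
  [set p | [/\ 0 <= p.1, 0 <= p.2 & p.1 + p.2 <= 1]].


Local Notation Delta1 := (set_type Delta1_set).
Local Notation Delta2 := (set_type Delta2_set).

Lemma Delta1_0 : (0 : R) \in Delta1_set.
Proof. by rewrite inE /Delta1_set /= lexx ler01. Qed.
Lemma Delta1_1 : (1 : R) \in Delta1_set.
Proof. by rewrite inE /Delta1_set /= lexx ler01. Qed.
Lemma Delta2_0 : ((0, 0) : R * R) \in Delta2_set.
Proof. by rewrite inE /Delta2_set /= lexx addr0 ler01. Qed.

Definition i0 : Delta1 := exist _ 0 Delta1_0.
Definition i1 : Delta1 := exist _ 1 Delta1_1.
Definition v0 : Delta2 := exist _ (0, 0) Delta2_0.

(* points given by coordinates (only used on coordinates inside the simplex) *)
Definition toD1 (t : R) : Delta1 :=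
  if pselect (t \in Delta1_set) is left h then exist _ t h else i0.
Definition toD2 (p : R * R) : Delta2 :=
  if pselect (p \in Delta2_set) is left h then exist _ p h else v0.

(** face maps Delta1 -> Delta2 : d_k omits vertex k *)
Definition d0 (t : Delta1) : Delta2 := toD2 (1 - sval t, sval t).
Definition d1 (t : Delta1) : Delta2 := toD2 (0, sval t).
Definition d2 (t : Delta1) : Delta2 := toD2 (sval t, 0).
End Simplices.

Notation Delta1 R := (set_type (@Delta1_set R)).
Notation Delta2 R := (set_type (@Delta2_set R)).

Definition path_connected (R : realType) (X : topologicalType) : Prop :=
  forall x y : X, exists g : Delta1 R -> X,
    [/\ continuous g, g (i0 R) = x & g (i1 R) = y].

Definition cofibration_pt (R : realType) (X : topologicalType) (e : X) : Prop :=
  forall (Y : topologicalType) (f : X -> Y) (h : Delta1 R -> Y),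
    continuous f -> continuous h -> h (i0 R) = f e ->
    exists F : (X * Delta1 R)%type -> Y,
      [/\ continuous F, forall x, F (x, i0 R) = f x & forall t, F (e, t) = h t].

Section Pi1.
Context (R : realType) (Y : topologicalType) (y : Y).

Definition is_loop (g : Delta1 R -> Y) : Prop :=
  [/\ continuous g, g (i0 R) = y & g (i1 R) = y].

Definition loop_htpy (g g' : Delta1 R -> Y) : Prop :=
  exists H : (Delta1 R * Delta1 R)%type -> Y,
    [/\ continuous H, forall t, H (t, i0 R) = g t, forall t, H (t, i1 R) = g' t
      & forall s, H (i0 R, s) = y /\ H (i1 R, s) = y].

Definition cst_loop : Delta1 R -> Y := fun _ => y.
Lemma cst_loopP : is_loop cst_loop.
Proof. by split => //; exact: cst_continuous. Qed.

Definition pi1 : Type := quot_of is_loop loop_htpy.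
Definition pi1_cls (g : Delta1 R -> Y) : pi1 := cls loop_htpy cst_loopP g.
Definition pi1_rep (a : pi1) : Delta1 R -> Y := rep a.

Definition loop_concat (g g' : Delta1 R -> Y) (t : Delta1 R) : Y :=
  if sval t <= 1 / 2 then g (toD1 (2 * sval t)) else g' (toD1 (2 * sval t - 1)).
Definition pi1_mul (a b : pi1) : pi1 := pi1_cls (loop_concat (pi1_rep a) (pi1_rep b)).
End Pi1.

(** * First singular homology H_1(X) (integer coefficients).
    A chain is a finite formal Z-combination of singular simplices, given
    as a list of (coefficient, simplex); two lists represent the same chain
    iff their coefficient functions [chain_ev] agree. *)
Section H1.
Context (R : realType) (X : topologicalType).

Definition kron {T : Type} (a b : T) : int := if `[< a = b >] then 1 else 0.
Definition chain_ev {T : Type} (c : seq (int * T)) (s : T) : int :=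
  \sum_(p <- c) p.1 * kron p.2 s.

Definition sing_chain {T : topologicalType} (c : seq (int * (T -> X))) : Prop :=
  forall p, p \in c -> continuous p.2.

Definition bd1 (c : seq (int * (Delta1 R -> X))) : seq (int * X) :=
  flatten [seq [:: (p.1, p.2 (i1 R)); (- p.1, p.2 (i0 R))] | p <- c].
Definition bd2 (b : seq (int * (Delta2 R -> X))) : seq (int * (Delta1 R -> X)) :=
  flatten [seq [:: (p.1, p.2 \o @d0 R); (- p.1, p.2 \o @d1 R); (p.1, p.2 \o @d2 R)]
          | p <- b].

Definition is_cycle1 (c : seq (int * (Delta1 R -> X))) : Prop :=
  sing_chain c /\ forall x, chain_ev (bd1 c) x = 0.

Definition homologous1 (c c' : seq (int * (Delta1 R -> X))) : Prop :=
  exists b : seq (int * (Delta2 R -> X)),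
    sing_chain b /\ forall s, chain_ev c s - chain_ev c' s = chain_ev (bd2 b) s.

Lemma nil_cycle1 : is_cycle1 [::].
Proof. by split => // x; rewrite /chain_ev /bd1 /= big_nil. Qed.

Definition H1 : Type := quot_of is_cycle1 homologous1.
Definition H1_cls (c : seq (int * (Delta1 R -> X))) : H1 := cls homologous1 nil_cycle1 c.
Definition H1_rep (a : H1) : seq (int * (Delta1 R -> X)) := rep a.

Definition H1_add (a b : H1) : H1 := H1_cls (H1_rep a ++ H1_rep b).

Definition hurewicz (e : X) (a : pi1 R e) : H1 := H1_cls [:: (1, pi1_rep a)].
End H1.

(** * James reduced product J(X).
    J(X) is the quotient of the topological disjoint union of the X^n
    (product topology) by identifying tuples with the same word after
    deleting the letters equal to e.  Its topology (quotient of the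
    disjoint union) is: U open iff q_n^{-1}(U) open in X^n for all n,
    i.e. the weak topology w.r.t. the quotients J_n(X) of X^n. *)
Section James.
Context (X : topologicalType) (e : X).

Local Notation James_pre := {n : nat & {ptws 'I_n -> X}}.

Definition jword (u : James_pre) : seq X :=
  [seq x <- [seq projT2 u i | i <- enum 'I_(projT1 u)] | x != e].

Definition jrel (u v : James_pre) : bool := jword u == jword v.

Lemma jrel_refl : reflexive jrel. Proof. by move=> u; rewrite /jrel. Qed.
Lemma jrel_sym : symmetric jrel. Proof. by move=> u v; rewrite /jrel eq_sym. Qed.
Lemma jrel_trans : transitive jrel.
Proof. by move=> v u w; rewrite /jrel => /eqP -> /eqP ->. Qed.

Definition jequiv := EquivRel jrel jrel_refl jrel_sym jrel_trans.

Definition James := quotient_topology {eq_quot jequiv}.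

Definition jsigma (x : X) : James :=
  \pi_James (existT _ 1%N (fun _ : 'I_1 => x) : James_pre).
End James.

Definition sigma_sharp (R : realType) (X : topologicalType) (e : X)
  (a : pi1 R e) : pi1 R (jsigma e e) :=
  pi1_cls (jsigma e e) (jsigma e \o pi1_rep a).

(* Main.v *)
Require Import Defs.
From HB Require Import structures.
From mathcomp Require Import all_boot all_order all_algebra generic_quotient.
From mathcomp Require Import all_classical all_reals topology normedtype.
From mathcomp Require Import lra ring ring_quotient.
Import numFieldNormedType.Exports.

Set Implicit Arguments.
Unset Strict Implicit.
Unset Printing Implicit Defensive.
Import Order.TTheory GRing.Theory Num.Theory.
Local Open Scope classical_set_scope.
Local Open Scope ring_scope.
Local Open Scope quotient_scope.

(** Both [hurewicz] and [sigma_sharp] are surjective homomorphisms out of [pi1 R e]; the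
    theorem says that they have the same kernel.

    The homotopy extension property gives a retraction of [X * [0,1]] onto
    [X * {0} \/ {e} * [0,1]], hence a level function [u : X -> R] with [u e = 0] and a
    deformation [h] of the identity, fixing [e], with [h x 1 = e] whenever [u x < 1].
    Given a point [z] of the domain of a map [f] into the James construction, pick a level
    [0 < c < 1] which is not attained by the letters of [f z]: near [z] the letters of level
    above [c] form a word of constant length whose letters move continuously, and all the
    other letters are killed by [h _ 1].  So after a deformation every map into the James
    construction lifts locally to a power of [X].

    - Surjectivity of [sigma_sharp]: cut a loop into liftable pieces and close up each piece
      letterwise; a pointwise product of loops is homotopic to their concatenation.  This
      also makes the fundamental group abelian, so that [sigma_sharp] extends to a cocycle
      on the paths of [X] and kills the kernel of [hurewicz].
    - Conversely, let [phi] be a cocycle on the paths of [X].  For a map [f] from a square to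
      the James construction, the sum of [phi] over the letters of the local lifts of [f]
      along short segments is locally the increment of a potential; these potentials glue
      over the square, and for a homotopy between [sigma o a] and [sigma o b] the increments
      along its sides give [phi a = phi b].  Take [phi] universal. *)

(** * Continuity of composite maps and pasting *)

Section RealContinuity.
Context {R : realType} {T : topologicalType}.
Implicit Types f g : T -> R.

Lemma contD f g : continuous f -> continuous g -> continuous (fun t => f t + g t).
Proof. by move=> cf cg t; apply: (@continuousD R R^o); [exact: cf|exact: cg]. Qed.

Lemma contN f : continuous f -> continuous (fun t => - f t).
Proof. by move=> cf t; apply: (@continuousN R R^o); exact: cf. Qed.

Lemma contM f g : continuous f -> continuous g -> continuous (fun t => f t * g t).
Proof. by move=> cf cg t; apply: continuousM; [exact: cf|exact: cg]. Qed.

Lemma contmin f g :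
  continuous f -> continuous g -> continuous (fun t => Num.min (f t) (g t)).
Proof. by move=> cf cg t; apply: continuous_min; [exact: cf|exact: cg]. Qed.

Lemma contmax f g :
  continuous f -> continuous g -> continuous (fun t => Num.max (f t) (g t)).
Proof. by move=> cf cg t; apply: continuous_max; [exact: cf|exact: cg]. Qed.
End RealContinuity.

Section GeneralContinuity.

Lemma contcst (T U : topologicalType) (x : U) : continuous (fun _ : T => x).
Proof. by move=> t; apply: cst_continuous. Qed.

Lemma contpair (T U V : topologicalType) (f : T -> U) (g : T -> V) :
  continuous f -> continuous g -> continuous (fun t => (f t, g t)).
Proof. by move=> cf cg t; apply: cvg_pair; [exact: cf|exact: cg]. Qed.

Lemma contcomp (T U V : topologicalType) (f : T -> U) (g : U -> V) :
  continuous f -> continuous g -> continuous (fun t => g (f t)).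
Proof. by move=> cf cg t; apply: (continuous_comp (cf t)); exact: cg. Qed.

Lemma cont_fst (T U : topologicalType) : continuous (@fst T U).
Proof. by move=> -[a b]; exact: cvg_fst. Qed.

Lemma cont_snd (T U : topologicalType) : continuous (@snd T U).
Proof. by move=> -[a b]; exact: cvg_snd. Qed.

Lemma contfst (T U V : topologicalType) (f : T -> U * V) :
  continuous f -> continuous (fun t => (f t).1).
Proof. by move=> cf; exact: (contcomp cf (@cont_fst U V)). Qed.

Lemma contsnd (T U V : topologicalType) (f : T -> U * V) :
  continuous f -> continuous (fun t => (f t).2).
Proof. by move=> cf; exact: (contcomp cf (@cont_snd U V)). Qed.

Lemma cont_sval (T : topologicalType) (A : set T) :
  continuous (fun x : set_type A => sval x).
Proof. exact: initial_continuous. Qed.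

Lemma cont_svalcomp (T U : topologicalType) (A : set T) (f : U -> set_type A) :
  continuous f -> continuous (fun x => sval (f x)).
Proof. by move=> cf; apply: (contcomp cf (@cont_sval _ A)). Qed.

Lemma cont_to_sub_at (T U : topologicalType) (A : set T) (f : U -> set_type A) u :
  {for u, continuous (fun x => sval (f x))} -> {for u, continuous f}.
Proof.
move=> cf B [_ /= [[C oC <-] Cfu] sB].
have /cf nC : nbhs (sval (f u)) C by exact: open_nbhs_nbhs.
by apply: (@filterS _ (nbhs u) _ _ _ _ nC) => x Cx; apply: sB.
Qed.

Lemma cont_to_sub (T U : topologicalType) (A : set T) (f : U -> set_type A) :
  continuous (fun x => sval (f x)) -> continuous f.
Proof. by move=> cf u; exact: (cont_to_sub_at (cf u)). Qed.

(** Off the level set [k t = b] a single branch is used near [t]; on it the branches agree, so a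
    neighbourhood that is good for both of them works. *)
Lemma cont_glue (R : realType) (T U : topologicalType) (k : T -> R) (b : R)
    (f g : T -> U) : continuous k -> continuous f -> continuous g ->
  (forall t, k t = b -> f t = g t) ->
  continuous (fun t => if k t <= b then f t else g t).
Proof.
move=> ck cf cg fg t A /=; case: (ltgtP (k t) b) => [ltb|gtb|eqb].
- move=> /cf nA; have nB := ck t _ (lt_nbhsl ltb).
  by apply: (@filterS2 _ (nbhs t) _ _ _ _ _ nA nB) => x Ax xb; rewrite /= ltW.
- move=> /cg nA; have nB := ck t _ (lt_nbhsr gtb).
  by apply: (@filterS2 _ (nbhs t) _ _ _ _ _ nA nB) => x Ax xb; rewrite /= leNgt xb.
- move=> nA; have nB := cf _ _ nA; rewrite (fg _ eqb) in nA; have nC := cg _ _ nA.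
  by apply: (@filterS2 _ (nbhs t) _ _ _ _ _ nB nC) => x Ax Bx /=; case: ifP.
Qed.

End GeneralContinuity.

(* Case analysis on the minima and maxima of the goal, innermost first so that none is
   left in the hypotheses. *)
Ltac mm_free x := lazymatch x with
  | context [Num.min _ _] => fail
  | context [Num.max _ _] => fail
  | _ => idtac
  end.
Ltac mm := repeat match goal with
  | |- context [Num.min ?x ?y] => mm_free x; mm_free y; case: (leP x y) => ?
  | |- context [Num.max ?x ?y] => mm_free x; mm_free y; case: (leP x y) => ?
  end.

(** * Retractions onto the standard simplices *)

Section Interval.
Context {R : realType}.

(** [toD1] sends every real outside the interval to [i0], which is discontinuous at 1. Retracting
    first makes [D1] continuous on the whole line, so paths can be handled as functions of a real
    variable. *)
Definition clamp (t : R) : R := Num.max 0 (Num.min 1 t).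
Definition D1 (t : R) : Delta1 R := toD1 (clamp t).

Lemma toD1E (t : R) : 0 <= t <= 1 -> sval (toD1 t) = t.
Proof. by move=> t01; rewrite /toD1; case: pselect => //; rewrite inE. Qed.

Lemma sval01 (t : Delta1 R) : 0 <= sval t <= 1.
Proof. by case: t => t /=; rewrite inE. Qed.

Lemma D1_clamp t : sval (D1 t) = clamp t.
Proof. by rewrite toD1E // /clamp; mm; lra. Qed.

Lemma clampE t : 0 <= t <= 1 -> clamp t = t.
Proof. by rewrite /clamp; mm; lra. Qed.

Lemma D1E t : 0 <= t <= 1 -> sval (D1 t) = t.
Proof. by rewrite D1_clamp; exact: clampE. Qed.

Lemma D1_toD1 t : 0 <= t <= 1 -> D1 t = toD1 t.
Proof. by rewrite /D1 => /clampE ->. Qed.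

Lemma D1_le0 t : t <= 0 -> D1 t = i0 R.
Proof.
move=> t0; apply: val_inj; rewrite /= [LHS]D1_clamp /clamp.
by mm; lra.
Qed.

Lemma D1_ge1 t : 1 <= t -> D1 t = i1 R.
Proof.
move=> t0; apply: val_inj; rewrite /= [LHS]D1_clamp /clamp.
by mm; lra.
Qed.

Lemma D1K (t : Delta1 R) : D1 (sval t) = t.
Proof. by apply: val_inj; apply: D1E; exact: sval01. Qed.

Lemma cont_clamp : continuous clamp.
Proof.
by apply: contmax (@contcst _ _ _) (contmin (@contcst _ _ _) _) => t; exact: cvg_id.
Qed.

Lemma cont_D1 : continuous D1.
Proof.
apply: cont_to_sub; rewrite (_ : (fun x => _) = clamp); first exact: cont_clamp.
by apply/funext => t; rewrite D1_clamp.
Qed.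

Lemma cont_D1comp (T : topologicalType) (f : T -> R) :
  continuous f -> continuous (fun t => D1 (f t)).
Proof. by move=> cf; apply: (contcomp cf cont_D1). Qed.

End Interval.

(* Eta-expansion makes the syntactic dispatch below apply to partial applications as well. *)
Ltac cont_eta := match goal with
  | |- continuous ?f => let g := eval cbv beta in (fun t => f t) in change (continuous g)
  end.

Ltac cont := repeat first
  [ assumption | exact: cont_sval | exact: cont_fst | exact: cont_snd | cont_eta; first
  [ match goal with
    | |- continuous (fun t => (_, _)) => apply: contpair
    | |- continuous (fun t => fst _) => apply: contfst
    | |- continuous (fun t => snd _) => apply: contsnd
    | |- continuous (fun t => sval _) => apply: cont_svalcomp
    | |- continuous (fun t => D1 _) => apply: cont_D1comp
    | |- continuous (fun t => _ + _) => apply: contD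
    | |- continuous (fun t => - _) => apply: contN
    | |- continuous (fun t => _ * _) => apply: contM
    | |- continuous (fun t => Num.min _ _) => apply: contmin
    | |- continuous (fun t => Num.max _ _) => apply: contmax
    | H : continuous ?F |- continuous (fun t => ?F (@?g t)) =>
        apply: (@contcomp _ _ _ g _ _ H)
    end
  | exact: contcst
  | by move=> ?; exact: cvg_id ] ].

Section Triangle.
Context {R : realType}.

Lemma sval_i0 : sval (i0 R) = 0. Proof. by []. Qed.
Lemma sval_i1 : sval (i1 R) = 1. Proof. by []. Qed.

(** A retraction of the plane onto the triangle: the second coordinate is cut off at the height left
    by the clamped first one. *)
Definition clamp2 (p : R * R) : R * R :=
  (clamp p.1, Num.max 0 (Num.min p.2 (1 - clamp p.1))).
Definition D2 (p : R * R) : Delta2 R := toD2 (clamp2 p).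

Lemma toD2E (p : R * R) : Delta2_set p -> sval (toD2 p) = p.
Proof. by move=> t01; rewrite /toD2; case: pselect => //; rewrite inE. Qed.

Lemma sval_D2 p : sval (D2 p) = clamp2 p.
Proof.
apply: toD2E; rewrite /clamp2 /Delta2_set /=; have := sval01 (D1 p.1).
rewrite D1_clamp; move: (clamp _) => c; set m := Num.max 0 _.
by rewrite {}/m; mm; split; lra.
Qed.

Lemma clamp2E p : Delta2_set p -> clamp2 p = p.
Proof.
case: p => x y [/= x0 y0 xy]; rewrite /clamp2 /= clampE; last by lra.
by congr (_, _); mm; lra.
Qed.

Lemma cont_D2 : continuous D2.
Proof.
apply: cont_to_sub; rewrite (_ : (fun x => _) = clamp2); last first.
  by apply/funext => t; rewrite sval_D2.
rewrite /clamp2.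
have c1 : continuous (fun p : R * R => clamp p.1).
  by apply: (contcomp _ cont_clamp); cont.
by cont.
Qed.

Lemma D2_toD2 p : Delta2_set p -> D2 p = toD2 p.
Proof. by rewrite /D2 => /clamp2E ->. Qed.

End Triangle.

(** * Paths and the fundamental groupoid *)

Section Paths.
Context {R : realType} {Y : topologicalType}.
Implicit Types (f g k : Delta1 R -> Y) (x y z : Y).

Definition is_path x y f := [/\ continuous f, f (i0 R) = x & f (i1 R) = y].

Definition path_htpy x y f g :=
  exists H : (Delta1 R * Delta1 R)%type -> Y,
    [/\ continuous H, forall t, H (t, i0 R) = f t, forall t, H (t, i1 R) = g t
      & forall s, H (i0 R, s) = x /\ H (i1 R, s) = y].

(* Straight-line homotopies in the plane: all reparametrizations are instances. *)
Lemma htpy_plane (F : R * R -> Y) (a b : Delta1 R -> R * R) x y :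
  continuous F -> continuous a -> continuous b ->
  a (i0 R) = b (i0 R) -> a (i1 R) = b (i1 R) ->
  F (a (i0 R)) = x -> F (a (i1 R)) = y -> path_htpy x y (F \o a) (F \o b).
Proof.
move=> cF ca cb e0 e1 <- <-.
pose L (p : Delta1 R * Delta1 R) : R * R :=
  ((a p.1).1 + sval p.2 * ((b p.1).1 - (a p.1).1),
   (a p.1).2 + sval p.2 * ((b p.1).2 - (a p.1).2)).
have ca' : continuous (fun p : Delta1 R * Delta1 R => a p.1).
  by apply: (contcomp _ ca); cont.
have cb' : continuous (fun p : Delta1 R * Delta1 R => b p.1).
  by apply: (contcomp _ cb); cont.
exists (F \o L); split.
- by apply: (contcomp _ cF); rewrite /L; cont.
- by move=> t; rewrite /L /= !mul0r !addr0 -surjective_pairing.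
- by move=> t; rewrite /L /= !mul1r ![_ + (_ - _)]addrC !subrK -surjective_pairing.
- by move=> s; rewrite /L /= e0 e1 !subrr !mulr0 !addr0 -!surjective_pairing.
Qed.

Lemma htpy_line (F : R -> Y) (a b : R -> R) x y :
  continuous F -> continuous a -> continuous b -> a 0 = b 0 -> a 1 = b 1 ->
  F (a 0) = x -> F (a 1) = y ->
  path_htpy x y (fun t => F (a (sval t))) (fun t => F (b (sval t))).
Proof.
move=> cF ca cb e0 e1 Fx Fy.
apply: (@htpy_plane (fun p => F p.1) (fun t => (a (sval t), 0)) (fun t => (b (sval t), 0))).
- by apply: (contcomp _ cF); cont.
- by cont; apply: (contcomp _ ca); cont.
- by cont; apply: (contcomp _ cb); cont.
- by rewrite /= e0.
- by rewrite /= e1.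
- by [].
- by [].
Qed.

(** The unit, inverse and associativity laws follow from this by writing both sides as
    reparametrizations of a single path. *)
Lemma htpy_reparam f (a b : R -> R) g k x y :
  continuous f -> continuous a -> continuous b ->
  (forall t, g t = f (D1 (a (sval t)))) -> (forall t, k t = f (D1 (b (sval t)))) ->
  a 0 = b 0 -> a 1 = b 1 -> f (D1 (a 0)) = x -> f (D1 (a 1)) = y ->
  path_htpy x y g k.
Proof.
move=> cf ca cb gE kE; rewrite (funext gE) (funext kE).
by apply: (@htpy_line (fun t => f (D1 t))) => //; cont.
Qed.

Lemma concatE f g t : loop_concat f g t =
  if sval t <= 1 / 2 then f (D1 (2 * sval t)) else g (D1 (2 * sval t - 1)).
Proof.
have t01 := sval01 t; rewrite /loop_concat; case: ifP => h.
  by rewrite D1_toD1 //; lra.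
by rewrite D1_toD1 //; lra.
Qed.

Lemma htpy_refl x y f : is_path x y f -> path_htpy x y f f.
Proof.
case=> cf f0 f1; exists (fun p => f p.1); split => //.
by apply: (contcomp _ cf); cont.
Qed.

Lemma htpy_sym x y f g : path_htpy x y f g -> path_htpy x y g f.
Proof.
case=> H [cH H0 H1 Hs]; exists (fun p => H (p.1, D1 (1 - sval p.2))); split.
- by apply: (contcomp _ cH); cont.
- by move=> t; rewrite sval_i0 D1_ge1 // subr0.
- by move=> t; rewrite sval_i1 D1_le0 // subrr.
- by move=> s; exact: Hs.
Qed.

Lemma htpy_trans x y g f k : path_htpy x y f g -> path_htpy x y g k -> path_htpy x y f k.
Proof.
case=> H [cH H0 H1 Hs] [K [cK K0 K1 Ks]].
exists (fun p => if sval p.2 <= 1 / 2 then H (p.1, D1 (2 * sval p.2))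
                 else K (p.1, D1 (2 * sval p.2 - 1))); split.
- apply: (@cont_glue R).
  + by cont.
  + by apply: (contcomp _ cH); cont.
  + by apply: (contcomp _ cK); cont.
  + by move=> [t s] /= ->; rewrite D1_ge1 ?D1_le0 ?H1 ?K0 //; lra.
- by move=> t /=; rewrite ifT ?D1_le0 //; lra.
- by move=> t /=; rewrite ifF ?D1_ge1 //; lra.
- by move=> s /=; case: ifP => _; [exact: Hs|exact: Ks].
Qed.

Lemma concat_path x y z f g :
  is_path x y f -> is_path y z g -> is_path x z (loop_concat f g).
Proof.
case=> cf f0 f1 [cg g0 g1]; split; last 2 first.
- by rewrite concatE /= ifT ?D1_le0 //; lra.
- by rewrite concatE /= ifF ?D1_ge1 //; lra.
rewrite (funext (concatE f g)).
apply: (@cont_glue R (Delta1 R) Y (fun t => sval t) (1 / 2)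
  (fun t => f (D1 (2 * sval t))) (fun t => g (D1 (2 * sval t - 1)))).
- by cont.
- by apply: (contcomp _ cf); cont.
- by apply: (contcomp _ cg); cont.
- by move=> t ->; rewrite D1_ge1 ?D1_le0 ?f1 ?g0 //; lra.
Qed.

Lemma htpy_concat x y z f f' g g' : path_htpy x y f f' -> path_htpy y z g g' ->
  path_htpy x z (loop_concat f g) (loop_concat f' g').
Proof.
case=> H [cH H0 H1 Hs] [K [cK K0 K1 Ks]].
exists (fun p => if sval p.1 <= 1 / 2 then H (D1 (2 * sval p.1), p.2)
                 else K (D1 (2 * sval p.1 - 1), p.2)); split.
- apply: (@cont_glue R).
  + by cont.
  + by apply: (contcomp _ cH); cont.
  + by apply: (contcomp _ cK); cont.
  + by move=> [t s] /= ->; rewrite D1_ge1 ?D1_le0 ?(Hs s).2 ?(Ks s).1 //; lra.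
- by move=> t /=; rewrite concatE H0 K0.
- by move=> t /=; rewrite concatE H1 K1.
- move=> s /=; rewrite ifT; last by lra.
  rewrite ifF; last by lra.
  by rewrite D1_le0 ?D1_ge1 ?(Hs s).1 ?(Ks s).2 //; lra.
Qed.

Definition rev_path f : Delta1 R -> Y := fun t => f (D1 (1 - sval t)).

Lemma rev_pathP x y f : is_path x y f -> is_path y x (rev_path f).
Proof.
case=> cf f0 f1; split.
- by apply: (contcomp _ cf); cont.
- by rewrite /rev_path D1_ge1 ?sval_i0 ?subr0.
- by rewrite /rev_path D1_le0 ?sval_i1 ?subrr.
Qed.

Lemma htpy_rev x y f g : path_htpy x y f g -> path_htpy y x (rev_path f) (rev_path g).
Proof.
case=> H [cH H0 H1 Hs]; exists (fun p => H (D1 (1 - sval p.1), p.2)); split.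
- by apply: (contcomp _ cH); cont.
- by move=> t; rewrite H0.
- by move=> t; rewrite H1.
- move=> s /=; rewrite [X in H (X, _) = _ /\ _]D1_ge1 ?subr0 //.
  by rewrite D1_le0 ?subrr ?(Hs s).1 ?(Hs s).2.
Qed.

Lemma cst_path x : is_path x x (fun=> x).
Proof. by split => //; exact: contcst. Qed.

Lemma concat_cst_l x y f : is_path x y f ->
  path_htpy x y (loop_concat (fun=> x) f) f.
Proof.
case=> cf f0 f1.
apply: (@htpy_reparam f (fun t => Num.max 0 (2 * t - 1)) id) => //; try by cont.
- move=> t; rewrite concatE; have := sval01 t; case: ifP => h t01.
    by rewrite D1_le0 //; mm; lra.
  by congr (f (D1 _)); mm; lra.
- by move=> t; rewrite D1K.
- by mm; lra.
- by mm; lra.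
- by rewrite D1_le0 //; mm; lra.
- by rewrite D1_ge1 //; mm; lra.
Qed.

Lemma concat_cst_r x y f : is_path x y f ->
  path_htpy x y (loop_concat f (fun=> y)) f.
Proof.
case=> cf f0 f1.
apply: (@htpy_reparam f (fun t => Num.min 1 (2 * t)) id) => //; try by cont.
- move=> t; rewrite concatE; have := sval01 t; case: ifP => h t01.
    by congr (f (D1 _)); mm; lra.
  by rewrite D1_ge1 //; mm; lra.
- by move=> t; rewrite D1K.
- by mm; lra.
- by mm; lra.
- by rewrite D1_le0 //; mm; lra.
- by rewrite D1_ge1 //; mm; lra.
Qed.

Lemma concat_rev x y f : is_path x y f ->
  path_htpy x x (loop_concat f (rev_path f)) (fun=> x).
Proof.
case=> cf f0 f1.
apply: (@htpy_reparam f (fun t => Num.min (2 * t) (2 - 2 * t)) (fun=> 0)) => //; try by cont.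
- move=> t; rewrite concatE; have := sval01 t; case: ifP => h t01.
    by congr (f (D1 _)); mm; lra.
  by rewrite /rev_path; congr (f (D1 _)); rewrite D1E; mm; lra.
- by move=> t; rewrite D1_le0.
- by mm; lra.
- by mm; lra.
- by rewrite D1_le0 //; mm; lra.
- by rewrite D1_le0 //; mm; lra.
Qed.

Lemma concatA w x y z f g k : is_path w x f -> is_path x y g -> is_path y z k ->
  path_htpy w z (loop_concat (loop_concat f g) k) (loop_concat f (loop_concat g k)).
Proof.
move=> pf pg pk; have pgk := concat_path pg pk; have [ch h0 h1] := concat_path pf pgk.
(* The change of parameter is concave and piecewise linear, with slopes 2, 1, 1/2 and breaks at 1/4
   and 1/2, hence a minimum of three affine maps. *)
apply: (@htpy_reparam (loop_concat f (loop_concat g k))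
  (fun t => Num.min (2 * t) (Num.min (t + 1 / 4) (t / 2 + 1 / 2))) id) => //; try by cont.
- move=> t; rewrite concatE; have := sval01 t; case: ifP => h2 t01.
    rewrite concatE D1E; last by lra.
    case: ifP => h3.
      rewrite concatE D1E; last by mm; lra.
      by rewrite ifT; last (by mm; lra); congr (f (D1 _)); mm; lra.
    rewrite concatE D1E; last by mm; lra.
    rewrite ifF; last by mm; lra.
    rewrite concatE D1E; last by mm; lra.
    by rewrite ifT; last (by mm; lra); congr (g (D1 _)); mm; lra.
  rewrite concatE D1E; last by mm; lra.
  rewrite ifF; last by mm; lra.
  rewrite concatE D1E; last by mm; lra.
  by rewrite ifF; last (by mm; lra); congr (k (D1 _)); mm; lra.
- by move=> t; rewrite D1K.
- by mm; lra.
- by mm; lra.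
- by rewrite D1_le0 //; mm; lra.
- by rewrite D1_ge1 //; mm; lra.
Qed.

End Paths.

(** * Quotient classes and composition of path classes *)

Section QuotOfTheory.
Context {T : Type} {P : set T} {r : T -> T -> Prop}.

Lemma quot_inj (A B : quot_of P r) : sval A = sval B -> A = B.
Proof. by case: A B => [A pA] [B pB] /= eAB; subst B; congr exist; exact: Prop_irrelevance. Qed.

(** Carrying the membership proof avoids the default element built into [cls]; [clsE] translates
    between the two. *)
Definition qcl (x : T) (Px : P x) : quot_of P r :=
  exist _ [set y | P y /\ r x y] (ex_intro2 _ _ x Px erefl).

Lemma repP (a : quot_of P r) : P (rep a).
Proof. by rewrite /rep; case: cid2. Qed.

Lemma qcl_rep (a : quot_of P r) (Pa : P (rep a)) : qcl Pa = a.
Proof.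
move: Pa; rewrite /rep; case: cid2 => /= x _ e Px.
by apply: quot_inj; rewrite e.
Qed.

Lemma clsE (x0 : T) (Px0 : P x0) (x : T) (Px : P x) : cls r Px0 x = qcl Px.
Proof. by apply: quot_inj; rewrite /= /fix_elt asboolT. Qed.

Hypotheses (rr : forall x, P x -> r x x) (rs : forall x y, r x y -> r y x)
  (rt : forall y x z, r x y -> r y z -> r x z).

Lemma qcl_eq (x y : T) (Px : P x) (Py : P y) : qcl Px = qcl Py <-> r x y.
Proof.
split=> [e|rxy].
  have : sval (qcl Py) y by split => //; exact: rr.
  by rewrite -e => -[].
apply: quot_inj; apply/seteqP; split => z [Pz rz]; split => //.
  exact: rt (rs rxy) rz.
exact: rt rxy rz.
Qed.

End QuotOfTheory.

Section Groupoid.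
Context {R : realType} {Y : topologicalType}.
Implicit Types (f g k : Delta1 R -> Y) (x y z : Y).

(** [hom y y] is convertible to [pi1 R y], so results on path classes apply to loops by mere type
    ascription. *)
Definition hom x y := quot_of (@is_path R Y x y) (@path_htpy R Y x y).

HB.instance Definition _ x y := gen_eqMixin (hom x y).
HB.instance Definition _ x y := gen_choiceMixin (hom x y).

Definition pcl x y f (Pf : is_path x y f) : hom x y := qcl Pf.

Lemma pcl_eq x y f g (Pf : is_path x y f) (Pg : is_path x y g) :
  pcl Pf = pcl Pg <-> path_htpy x y f g.
Proof.
by apply: qcl_eq; [exact: htpy_refl|exact: htpy_sym|exact: htpy_trans].
Qed.

Lemma homP x y (a : hom x y) : exists f (Pf : is_path x y f), a = pcl Pf.
Proof. by exists (rep a), (repP a); rewrite /pcl qcl_rep. Qed.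

Definition hmul x y z (a : hom x y) (b : hom y z) : hom x z :=
  pcl (concat_path (repP a) (repP b)).
Definition hinv x y (a : hom x y) : hom y x := pcl (rev_pathP (repP a)).
Definition hone x : hom x x := pcl (cst_path x).

Lemma pcl_rep_htpy x y f (Pf : is_path x y f) : path_htpy x y (rep (pcl Pf)) f.
Proof. by apply/(pcl_eq (repP (pcl Pf)) Pf); rewrite /pcl qcl_rep. Qed.

Lemma hmul_pcl x y z f g (Pf : is_path x y f) (Pg : is_path y z g) :
  hmul (pcl Pf) (pcl Pg) = pcl (concat_path Pf Pg).
Proof. by apply/pcl_eq/htpy_concat; apply: pcl_rep_htpy. Qed.

Lemma hinv_pcl x y f (Pf : is_path x y f) : hinv (pcl Pf) = pcl (rev_pathP Pf).
Proof. by apply/pcl_eq/htpy_rev; exact: pcl_rep_htpy. Qed.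

Lemma hmulA w x y z (a : hom w x) (b : hom x y) (c : hom y z) :
  hmul a (hmul b c) = hmul (hmul a b) c.
Proof.
have [f [Pf ->]] := homP a; have [g [Pg ->]] := homP b; have [k [Pk ->]] := homP c.
by rewrite !hmul_pcl; apply/pcl_eq/htpy_sym; exact: (concatA Pf Pg Pk).
Qed.

Lemma hmul1l x y (a : hom x y) : hmul (hone x) a = a.
Proof.
by have [f [Pf ->]] := homP a; rewrite hmul_pcl; apply/pcl_eq; exact: (concat_cst_l Pf).
Qed.

Lemma hmul1r x y (a : hom x y) : hmul a (hone y) = a.
Proof.
by have [f [Pf ->]] := homP a; rewrite hmul_pcl; apply/pcl_eq; exact: (concat_cst_r Pf).
Qed.

Lemma hmulV x y (a : hom x y) : hmul a (hinv a) = hone x.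
Proof.
by have [f [Pf ->]] := homP a; rewrite hinv_pcl hmul_pcl; apply/pcl_eq; exact: (concat_rev Pf).
Qed.

Lemma hinvK x y (a : hom x y) : hinv (hinv a) = a.
Proof.
have [f [Pf ->]] := homP a; rewrite !hinv_pcl; apply/pcl_eq.
rewrite (_ : rev_path _ = f); first exact: htpy_refl.
apply/funext => t; rewrite /rev_path D1E; last by have := sval01 t; lra.
by rewrite opprB addrC subrK D1K.
Qed.

Lemma hmulVl x y (a : hom x y) : hmul (hinv a) a = hone y.
Proof. by rewrite -{2}(hinvK a) hmulV. Qed.

Lemma hmulKV x y z (a : hom x y) (b : hom y z) : hmul (hinv a) (hmul a b) = b.
Proof. by rewrite hmulA hmulVl hmul1l. Qed.

(** The square is convex: either way round its boundary slides along straight lines onto the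
    diagonal. Equating the two ways yields commutation relations. *)
Lemma hmul_square (F : R * R -> Y) x y z w (d : Delta1 R -> Y)
    (p : Delta1 R -> Y) (q : Delta1 R -> Y) (p' : Delta1 R -> Y) (q' : Delta1 R -> Y)
    (Pp : is_path x y p) (Pq : is_path y z q) (Pp' : is_path w z p') (Pq' : is_path x w q') :
  continuous F ->
  (forall t, p t = F (sval t, 0)) -> (forall t, q t = F (1, sval t)) ->
  (forall t, p' t = F (sval t, 1)) -> (forall t, q' t = F (0, sval t)) ->
  (forall t, d t = F (sval t, sval t)) ->
  exists Pd : is_path x z d,
    pcl Pd = hmul (pcl Pp) (pcl Pq) /\ pcl Pd = hmul (pcl Pq') (pcl Pp').
Proof.
move=> cF pE qE p'E q'E dE.
have [_ p0 p1] := Pp; have [_ q0 q1] := Pq.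
have Pd : is_path x z d.
  split; last 2 first.
  - by rewrite dE -p0 pE.
  - by rewrite dE -q1 qE.
  by rewrite (funext dE); cont.
exists Pd; rewrite !hmul_pcl; split; apply/pcl_eq/htpy_sym.
- rewrite (_ : loop_concat p q = F \o
      (fun t : Delta1 R => (Num.min 1 (2 * sval t), Num.max 0 (2 * sval t - 1)))); last first.
    apply/funext => t; rewrite concatE /= pE qE; have := sval01 t; case: ifP => h t01.
      by rewrite D1E; [congr (F (_, _)); mm; lra|lra].
    by rewrite D1E; [congr (F (_, _)); mm; lra|lra].
  rewrite (funext dE); apply: (@htpy_plane R Y F _ (fun t : Delta1 R => (sval t, sval t))) => //; try by cont.
  + by rewrite /=; congr (_, _); mm; lra.
  + by rewrite /=; congr (_, _); mm; lra.
  + by rewrite -p0 pE /=; congr (F (_, _)); mm; lra.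
  + by rewrite -q1 qE /=; congr (F (_, _)); mm; lra.
- rewrite (_ : loop_concat q' p' = F \o
      (fun t : Delta1 R => (Num.max 0 (2 * sval t - 1), Num.min 1 (2 * sval t)))); last first.
    apply/funext => t; rewrite concatE /= p'E q'E; have := sval01 t; case: ifP => h t01.
      by rewrite D1E; [congr (F (_, _)); mm; lra|lra].
    by rewrite D1E; [congr (F (_, _)); mm; lra|lra].
  rewrite (funext dE); apply: (@htpy_plane R Y F _ (fun t : Delta1 R => (sval t, sval t))) => //; try by cont.
  + by rewrite /=; congr (_, _); mm; lra.
  + by rewrite /=; congr (_, _); mm; lra.
  + by rewrite -p0 pE /=; congr (F (_, _)); mm; lra.
  + by rewrite -q1 qE /=; congr (F (_, _)); mm; lra.
Qed.

Lemma d0E (t : Delta1 R) : d0 t = D2 (1 - sval t, sval t).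
Proof. by rewrite D2_toD2 //; have := sval01 t; split => /=; lra. Qed.
Lemma d1E (t : Delta1 R) : d1 t = D2 (0, sval t).
Proof. by rewrite D2_toD2 //; have := sval01 t; split => /=; lra. Qed.
Lemma d2E (t : Delta1 R) : d2 t = D2 (sval t, 0).
Proof. by rewrite D2_toD2 //; have := sval01 t; split => /=; lra. Qed.

(** The broken path from (0,0) through (1,0) to (0,1) slides along straight lines to the remaining
    edge; [D2] extends [s] to the plane. *)
Lemma hmul_triangle (s : Delta2 R -> Y) x y z : continuous s ->
  (s \o @d2 R) (i0 R) = x -> (s \o @d2 R) (i1 R) = y -> (s \o @d0 R) (i1 R) = z ->
  exists (P2 : is_path x y (s \o @d2 R)) (P0 : is_path y z (s \o @d0 R))
    (P1 : is_path x z (s \o @d1 R)), hmul (pcl P2) (pcl P0) = pcl P1.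
Proof.
rewrite /= => cs e0 e1 e2.
have cD := @cont_D2 R.
have P2 : is_path x y (s \o @d2 R).
  split; [|by []|by []]; rewrite (_ : s \o _ = fun t : Delta1 R => s (D2 (sval t, 0))); first by cont.
  by apply/funext => t; rewrite /= d2E.
have P0 : is_path y z (s \o @d0 R).
  split; [| |by []]; last first.
    by rewrite /= d0E -e1 d2E /= subr0.
  rewrite (_ : s \o _ = fun t : Delta1 R => s (D2 (1 - sval t, sval t))); first by cont.
  by apply/funext => t; rewrite /= d0E.
have P1 : is_path x z (s \o @d1 R).
  split.
  - rewrite (_ : s \o _ = fun t : Delta1 R => s (D2 (0, sval t))); first by cont.
    by apply/funext => t; rewrite /= d1E.
  - by rewrite /= d1E -e0 d2E.
  - by rewrite /= d1E -e2 d0E /= subrr.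
exists P2, P0, P1; rewrite hmul_pcl; apply/pcl_eq.
rewrite (_ : loop_concat _ _ = (fun p => s (D2 p)) \o
  (fun t : Delta1 R => (Num.min (2 * sval t) (2 - 2 * sval t), Num.max 0 (2 * sval t - 1)))); last first.
  apply/funext => t; rewrite concatE /= d0E d2E; have := sval01 t; case: ifP => h t01.
    by rewrite D1E; [congr (s (D2 (_, _))); mm; lra|lra].
  by rewrite D1E; [congr (s (D2 (_, _))); mm; lra|lra].
rewrite (_ : s \o @d1 R = (fun p => s (D2 p)) \o (fun t : Delta1 R => (0, sval t))); last first.
  by apply/funext => t; rewrite /= d1E.
apply: htpy_plane; try by cont.
- by rewrite /=; congr (_, _); mm; lra.
- by rewrite /=; congr (_, _); mm; lra.
- by rewrite -e0 d2E; congr (s (D2 (_, _))); rewrite /=; mm; lra.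
- by rewrite -e2 d0E; congr (s (D2 (_, _))); rewrite /=; mm; lra.
Qed.

(** No order between [a] and [b] is imposed: a segment may run backwards, and [hmul_seg] holds for
    parameters in any order. *)
Definition seg (p : R -> Y) (a b : R) : Delta1 R -> Y := fun t => p (a + sval t * (b - a)).

Lemma segP (p : R -> Y) a b : continuous p -> is_path (p a) (p b) (seg p a b).
Proof.
move=> cp; split; rewrite /seg ?sval_i0 ?sval_i1 ?mul0r ?mul1r ?addr0 //; first by cont.
by rewrite addrC subrK.
Qed.

Lemma hmul_seg (p : R -> Y) (cp : continuous p) a b c :
  hmul (pcl (segP a b cp)) (pcl (segP b c cp)) = pcl (segP a c cp).
Proof.
rewrite hmul_pcl; apply/pcl_eq.
rewrite (_ : loop_concat _ _ = fun t : Delta1 R => p ((fun t =>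
  a + Num.min 1 (2 * t) * (b - a) + Num.max 0 (2 * t - 1) * (c - b)) (sval t))); last first.
  apply/funext => t; rewrite concatE /seg; have := sval01 t; case: ifP => h t01.
    have -> : Num.min 1 (2 * sval t) = 2 * sval t by mm; lra.
    have -> : Num.max 0 (2 * sval t - 1) = 0 by mm; lra.
    by rewrite D1E; [congr (p _); ring|lra].
  have -> : Num.min 1 (2 * sval t) = 1 by mm; lra.
  have -> : Num.max 0 (2 * sval t - 1) = 2 * sval t - 1 by mm; lra.
  by rewrite D1E; [congr (p _); ring|lra].
apply: (@htpy_line R Y p
  (fun t => a + Num.min 1 (2 * t) * (b - a) + Num.max 0 (2 * t - 1) * (c - b))
  (fun t => a + t * (c - a))); try by cont.
- by mm; lra.
- by mm; lra.
- by congr (p _); mm; lra.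
- by congr (p _); mm; lra.
Qed.

End Groupoid.

(** * Cocycles on paths and first homology *)

Section Chains.
Context {R : realType} {X : topologicalType}.
Implicit Types (A : zmodType) (f g : Delta1 R -> X).

(** This is the vanishing of [phi] on boundaries of singular triangles; values on discontinuous
    functions are left free. *)
Definition cocycle A (phi : (Delta1 R -> X) -> A) := forall s : Delta2 R -> X,
  continuous s -> phi (s \o @d2 R) + phi (s \o @d0 R) = phi (s \o @d1 R).

Definition csum A (T : Type) (phi : T -> A) (c : seq (int * T)) : A :=
  \sum_(p <- c) phi p.2 *~ p.1.

Lemma csum_cat A T (phi : T -> A) c c' : csum phi (c ++ c') = csum phi c + csum phi c'.
Proof. by rewrite /csum big_cat. Qed.

Lemma csum1 A T (phi : T -> A) x : csum phi [:: (1, x)] = phi x.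
Proof. by rewrite /csum big_seq1. Qed.

Lemma chain_ev_cat T (c c' : seq (int * T)) s :
  chain_ev (c ++ c') s = chain_ev c s + chain_ev c' s.
Proof. by rewrite /chain_ev big_cat. Qed.

Definition copp T (c : seq (int * T)) : seq (int * T) := [seq (- p.1, p.2) | p <- c].

Lemma csum_opp A T (phi : T -> A) c : csum phi (copp c) = - csum phi c.
Proof.
by rewrite /csum big_map -sumrN; apply: eq_bigr => p _; rewrite mulrNz.
Qed.

Lemma chain_ev_opp T (c : seq (int * T)) s : chain_ev (copp c) s = - chain_ev c s.
Proof.
by rewrite /chain_ev big_map -sumrN; apply: eq_bigr => p _; rewrite mulNr.
Qed.

(** Collecting the terms by simplex turns the sum into one weighted by the coefficients
    [chain_ev c s], so it depends only on the chain and not on the list. *)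
Lemma csum_ev0 A (T : eqType) (phi : T -> A) c :
  (forall s, chain_ev c s = 0) -> csum phi c = 0.
Proof.
move=> c0; pose S := undup (map snd c).
transitivity (\sum_(p <- c) \sum_(s <- S) phi s *~ (p.1 * kron p.2 s)).
  rewrite /csum !big_seq; apply: eq_bigr => p pc.
  have pS : p.2 \in S by rewrite mem_undup; apply: map_f.
  rewrite (bigD1_seq p.2) ?undup_uniq //= big1 => [|s sp].
    by rewrite addr0 /kron asboolT // mulr1.
  by rewrite /kron asboolF ?mulr0 ?mulr0z // => e; rewrite e eqxx in sp.
rewrite exchange_big big1 // => s _; rewrite -[RHS](mulr0z (phi s)) -(c0 s).
by rewrite /chain_ev mulrz_sumr.
Qed.

Lemma csum_bd2 A (phi : (Delta1 R -> X) -> A) b :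
  cocycle phi -> sing_chain b -> csum phi (bd2 b) = 0.
Proof.
move=> co; elim: b => [|p b IH] sb; first by rewrite /csum /bd2 big_nil.
rewrite [bd2 _](_ : _ = bd2 [:: p] ++ bd2 b); last by rewrite /bd2 /= .
rewrite csum_cat IH ?addr0; last by move=> q qb; apply: sb; rewrite inE qb orbT.
have cp : continuous p.2 by apply: sb; rewrite inE eqxx.
rewrite /csum /bd2 /= !big_cons big_nil addr0 /= mulrNz -mulNrz -!mulrzDl_tmp.
by rewrite -(co _ cp) opprD addrAC addNr add0r subrr mul0rz.
Qed.

Lemma homologous_csum A (phi : (Delta1 R -> X) -> A) c c' :
  cocycle phi -> homologous1 c c' -> csum phi c = csum phi c'.
Proof.
move=> co [b [sb cb]]; apply/eqP; rewrite -subr_eq0; apply/eqP.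
rewrite (_ : _ - _ = csum phi (c ++ copp c' ++ copp (bd2 b))); last first.
  by rewrite !csum_cat !csum_opp (csum_bd2 co sb) oppr0 addr0.
by apply: csum_ev0 => s; rewrite !chain_ev_cat !chain_ev_opp -cb addrA subrr.
Qed.

(** Boundaries are taken as coefficient functions, because these form a group whereas lists do
    not. *)
Definition boundary : pred ((Delta1 R -> X) -> int) :=
  fun v => `[< exists b, sing_chain b /\ v = chain_ev (@bd2 R X b) >].

Lemma bd2_cat (b b' : seq (int * (Delta2 R -> X))) : bd2 (b ++ b') = bd2 b ++ bd2 b'.
Proof. by rewrite /bd2 map_cat flatten_cat. Qed.

Lemma bd2_opp (b : seq (int * (Delta2 R -> X))) : bd2 (copp b) = copp (bd2 b).
Proof.
by rewrite /bd2 /copp map_flatten -!map_comp; congr flatten; apply: eq_map.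
Qed.

Lemma boundary_zmod_closed : zmod_closed boundary.
Proof.
split.
  apply/asboolP; exists [::]; split=> //; apply/funext => s.
  by rewrite /chain_ev /bd2 /= big_nil.
move=> u v /asboolP [b [sb ->]] /asboolP [b' [sb' ->]]; apply/asboolP.
exists (b ++ copp b'); split.
  move=> p; rewrite mem_cat => /orP [/sb //|/mapP [q /sb' ? ->]] //.
by apply/funext => s; rewrite bd2_cat bd2_opp chain_ev_cat chain_ev_opp.
Qed.

(** [A] consists of the integer functions on paths modulo boundaries, and [phi] sends a path to the
    class of its indicator function; equality in [A] is then homology by construction. *)
Lemma universal_cocycle : exists (A : zmodType) (phi : (Delta1 R -> X) -> A),
  cocycle phi /\ forall c c', homologous1 c c' <-> csum phi c = csum phi c'.
Proof.
pose B : GRing.ZmodClosed.type ((Delta1 R -> X) -> int) :=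
  HB.pack boundary (GRing.isZmodClosed.Build _ boundary boundary_zmod_closed).
pose A : zmodType := Quotient.quot B.
pose q (v : (Delta1 R -> X) -> int) : A := \pi_A v.
pose phi s := q (fun s' => kron s s').
have qD u v : q (u + v) = q u + q v by exact: raddfD.
have q_csum c : csum phi c = q (chain_ev c).
  elim: c => [|p c IH].
    rewrite /csum big_nil (_ : chain_ev _ = 0); first by rewrite /q raddf0.
    by apply/funext => s; rewrite /chain_ev big_nil.
  rewrite /csum big_cons -/(csum phi c) IH.
  rewrite (_ : chain_ev (p :: c) = (fun s => p.1 * kron p.2 s) + chain_ev c); last first.
    by apply/funext => s; rewrite /chain_ev big_cons.
  rewrite qD; congr (_ + _); rewrite /phi /q -raddfMz; congr (\pi _).
  apply/funext => s.
  have muln (w : (Delta1 R -> X) -> int) k : (w *+ k) s = w s *+ k.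
    by elim: k => [|k IHk]; rewrite ?mulr0n // !mulrS -IHk.
  have mulz (w : (Delta1 R -> X) -> int) n : (w *~ n) s = n * w s.
    rewrite mulrC -mulrzz; case: n => n; first exact: muln.
    by rewrite !NegzE !mulrNz -!pmulrn -muln.
  by rewrite mulz.
exists A, phi.
have main c c' : homologous1 c c' <-> csum phi c = csum phi c'.
  rewrite !q_csum; split => [[b [sb cb]]|].
    apply/eqP; rewrite /q piE /Quotient.equiv; apply/asboolP; exists b; split => //.
    by apply/funext => s; rewrite -cb.
  move=> /eqP; rewrite /q piE /Quotient.equiv => /asboolP [b [sb cb]].
  by exists b; split => // s; rewrite -cb.
split=> // s cs.
(* The cocycle identity expresses that the boundary of a single triangle is homologous to the empty
   chain. *)
have := (main (bd2 [:: (1, s)]) [::]).1; rewrite /csum /bd2 /= !big_cons !big_nil.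
rewrite addr0 /= !mulr1z mulrN1z => h; apply/eqP; rewrite -subr_eq0 addrAC addrC addrCA addrC -h //.
  by rewrite addrA addrC addrA [X in X + _]addrC.
exists [:: (1, s)]; split; first by move=> p; rewrite inE => /eqP ->.
by move=> s'; rewrite [X in _ - X]big_nil subr0.
Qed.
End Chains.

Section Cocycles.
Context {R : realType} {X : topologicalType} {A : zmodType}.
Variables (phi : (Delta1 R -> X) -> A) (co : cocycle phi).
Implicit Types f g : Delta1 R -> X.

(** Continuity is asked only at the points of the triangle, since the local lifts to which this is
    applied are continuous only on small boxes. *)
Lemma cocycle_plane (F : R * R -> X) (a b c : Delta1 R -> X) :
  (forall p, Delta2_set p -> {for p, continuous F}) ->
  (forall t, a t = F (sval t, 0)) -> (forall t, b t = F (1 - sval t, sval t)) ->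
  (forall t, c t = F (0, sval t)) -> phi a + phi b = phi c.
Proof.
move=> cF aE bE cE; pose s (q : Delta2 R) := F (sval q).
have cs : continuous s.
  move=> q; apply: continuous_comp; first exact: cont_sval.
  by apply: cF; have := svalP q; rewrite inE.
have sD p : Delta2_set p -> s (D2 p) = F p by move=> dp; rewrite /s sval_D2 clamp2E.
rewrite (_ : a = s \o @d2 R); last first.
  apply/funext => t; rewrite /= d2E sD ?aE //.
  by have := sval01 t; split => /=; lra.
rewrite (_ : b = s \o @d0 R); last first.
  apply/funext => t; rewrite /= d0E sD ?bE //.
  by have := sval01 t; split => /=; lra.
rewrite (_ : c = s \o @d1 R); first exact: co.
apply/funext => t; rewrite /= d1E sD ?cE //.
by have := sval01 t; split => /=; lra.
Qed.

Lemma cocycle_cst x : phi (fun=> x) = 0.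
Proof.
have := @cocycle_plane (fun=> x) (fun=> x) (fun=> x) (fun=> x).
move=> /(_ (fun p _ => @contcst _ _ x p) (fun=> erefl) (fun=> erefl) (fun=> erefl)).
by move=> /(canRL (addrK _)); rewrite subrr.
Qed.

(** The diagonal cuts the square of the homotopy into two triangles; the two constant sides
    contribute nothing. *)
Lemma cocycle_htpy x y f g : path_htpy x y f g -> phi f = phi g.
Proof.
case=> H [cH H0 H1 Hs].
pose G (p : R * R) := H (D1 p.1, D1 p.2).
have cG : continuous G by rewrite /G; cont.
have e1 : phi f + phi (fun=> y) = phi (fun t => G (sval t, sval t)).
  apply: (@cocycle_plane (fun p => G (p.1 + p.2, p.2))).
  - by move=> p _; have : continuous (fun p : R * R => G (p.1 + p.2, p.2)); [cont|apply].
  - by move=> t; rewrite /G /= addr0 D1K D1_le0.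
  - by move=> t; rewrite /G /= subrK D1_ge1 // (Hs _).2.
  - by move=> t; rewrite /= add0r.
have e2 : phi (fun=> x) + phi g = phi (fun t => G (sval t, sval t)).
  apply: (@cocycle_plane (fun p => G (p.2, p.1 + p.2))).
  - by move=> p _; have : continuous (fun p : R * R => G (p.2, p.1 + p.2)); [cont|apply].
  - by move=> t; rewrite /G /= D1_le0 // (Hs _).1.
  - by move=> t; rewrite /G /= subrK D1K D1_ge1 // H1.
  - by move=> t; rewrite /= add0r.
by move: e1 e2; rewrite !cocycle_cst addr0 add0r => -> ->.
Qed.

(** A degenerate triangle is used: its vertices go to the parameters 0, 1/2 and 1 of the
    concatenation. *)
Lemma cocycle_concat x y z f g : is_path x y f -> is_path y z g ->
  phi (loop_concat f g) = phi f + phi g.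
Proof.
move=> Pf Pg; have [ck _ _] := concat_path Pf Pg.
have [_ f0 f1] := Pf; have [_ g0 g1] := Pg.
symmetry; apply: (@cocycle_plane (fun p => loop_concat f g (D1 (p.1 / 2 + p.2)))).
- move=> p _; have : continuous (fun p : R * R => loop_concat f g (D1 (p.1 / 2 + p.2))).
    by cont.
  by apply.
- move=> t; have := sval01 t => t01; rewrite concatE /= addr0 D1E; last by lra.
  by rewrite ifT; [rewrite -{1}(D1K t); congr (f (D1 _)); field|lra].
- move=> t; have := sval01 t => t01; rewrite concatE /= D1E; last by lra.
  case: ifP => h.
    have -> : sval t = 0 by lra.
    rewrite D1_ge1; last by lra.
    by rewrite f1 -g0; congr g; apply: val_inj => /=; lra.
  by rewrite -{1}(D1K t); congr (g (D1 _)); field.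
- by move=> t; rewrite /= mul0r add0r D1K.
Qed.

Lemma cocycle_rev f : continuous f -> phi (rev_path f) = - phi f.
Proof.
move=> cf; have e : phi f + phi (rev_path f) = phi (fun=> f (i0 R)).
  apply: (@cocycle_plane (fun p => f (D1 p.1))).
  - by move=> p _; have : continuous (fun p : R * R => f (D1 p.1)); [cont|apply].
  - by move=> t; rewrite D1K.
  - by [].
  - by move=> t; rewrite D1_le0.
by apply/eqP; rewrite -addr_eq0 addrC e cocycle_cst.
Qed.

Definition segx (l : R * R -> X) (z w : R * R) : Delta1 R -> X :=
  fun t => l (z.1 + sval t * (w.1 - z.1), z.2 + sval t * (w.2 - z.2)).

Lemma cocycle_segx (l : R * R -> X) z w v :
  (forall a b, 0 <= a -> 0 <= b -> a + b <= 1 -> {for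
     (z.1 + a * (w.1 - z.1) + b * (v.1 - z.1), z.2 + a * (w.2 - z.2) + b * (v.2 - z.2)),
     continuous l}) ->
  phi (segx l z w) + phi (segx l w v) = phi (segx l z v).
Proof.
move=> cl; pose K (p : R * R) : R * R :=
  (z.1 + p.1 * (w.1 - z.1) + p.2 * (v.1 - z.1), z.2 + p.1 * (w.2 - z.2) + p.2 * (v.2 - z.2)).
have cK : continuous K by rewrite /K; cont.
apply: (@cocycle_plane (l \o K)).
- by move=> p [p1 p2 p12]; apply: continuous_comp; [exact: cK|exact: cl].
- by move=> t; rewrite /segx /K /=; congr (l (_, _)); ring.
- by move=> t; rewrite /segx /K /=; congr (l (_, _)); ring.
- by move=> t; rewrite /segx /K /=; congr (l (_, _)); ring.
Qed.
End Cocycles.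

(** * Homology classes and the Hurewicz homomorphism *)

Section HomologyClasses.
Context {R : realType} {X : topologicalType} {A : zmodType}.
Variables (phi : (Delta1 R -> X) -> A) (co : cocycle phi).
Hypothesis univ : forall c c', homologous1 c c' <-> csum phi c = csum phi c'.

(** For the universal [phi] this embeds the first homology group into [A], where identities between
    classes can be checked. *)
Definition H1_val (a : H1 R X) : A := csum phi (H1_rep a).

Lemma H1_clsE (c : seq (int * (Delta1 R -> X))) (Pc : is_cycle1 c) : H1_cls c = qcl Pc.
Proof. exact: clsE. Qed.

Lemma H1_rep_cycle (a : H1 R X) : is_cycle1 (H1_rep a). Proof. exact: repP. Qed.

Lemma H1_repK (a : H1 R X) : H1_cls (H1_rep a) = a.
Proof. by rewrite (H1_clsE (H1_rep_cycle a)); exact: qcl_rep. Qed.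

Lemma H1_cls_eq (c c' : seq (int * (Delta1 R -> X))) : is_cycle1 c -> is_cycle1 c' ->
  H1_cls c = H1_cls c' <-> csum phi c = csum phi c'.
Proof.
move=> Pc Pc'; rewrite !H1_clsE -univ; apply: qcl_eq.
- by move=> x _; apply/univ.
- by move=> x y /univ ?; apply/univ.
- by move=> y x z /univ xy /univ ?; apply/univ; rewrite xy.
Qed.

Lemma H1_val_cls (c : seq (int * (Delta1 R -> X))) :
  is_cycle1 c -> H1_val (H1_cls c) = csum phi c.
Proof.
by move=> Pc; apply/H1_cls_eq; rewrite ?H1_repK //; exact: H1_rep_cycle.
Qed.

Lemma H1_val_inj : injective H1_val.
Proof.
move=> a b /(H1_cls_eq (H1_rep_cycle a) (H1_rep_cycle b)).
by rewrite !H1_repK.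
Qed.

Lemma cycle_cat (c c' : seq (int * (Delta1 R -> X))) :
  is_cycle1 c -> is_cycle1 c' -> is_cycle1 (c ++ c').
Proof.
move=> [sc bc] [sc' bc']; split => [p|x].
  by rewrite mem_cat => /orP [/sc|/sc'].
by rewrite /bd1 map_cat flatten_cat chain_ev_cat bc bc'.
Qed.

Lemma H1_val_add a b : H1_val (H1_add a b) = H1_val a + H1_val b.
Proof.
by rewrite H1_val_cls ?csum_cat //; apply: cycle_cat; exact: H1_rep_cycle.
Qed.

Lemma loop_cycle e (f : Delta1 R -> X) : is_path e e f -> is_cycle1 [:: (1, f)].
Proof.
move=> [cf f0 f1]; split => [p|x]; first by rewrite inE => /eqP ->.
by rewrite /chain_ev /bd1 /= !big_cons big_nil /= f0 f1 addr0 mul1r mulN1r subrr.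
Qed.

Lemma H1_val_hurewicz (e : X) (a : pi1 R e) : H1_val (hurewicz a) = phi (pi1_rep a).
Proof.
rewrite /hurewicz H1_val_cls ?csum1 //; apply: (@loop_cycle e).
exact: (@repP _ (is_loop e) _ a).
Qed.

Lemma H1_val_hurewicz_pcl e (f : Delta1 R -> X) (Pf : is_path e e f) :
  H1_val (hurewicz (pcl Pf : pi1 R e)) = phi f.
Proof. by rewrite H1_val_hurewicz; apply: (cocycle_htpy co (pcl_rep_htpy Pf)). Qed.

(** The values of [phi] on loops at [e] form a subgroup [S]. Joining the ends of each path of a
    chain to [e] puts the value of the chain in [S] up to a term in its boundary, which vanishes for
    a cycle. *)
Lemma hurewicz_surj (e : X) : path_connected R X ->
  forall a : H1 R X, exists b : pi1 R e, hurewicz b = a.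
Proof.
move=> pc.
pose S v := exists f, is_path e e f /\ phi f = v.
have S0 : S 0 by exists (fun=> e); split; [exact: cst_path|exact: cocycle_cst].
have SD v w : S v -> S w -> S (v + w).
  move=> [f [Pf <-]] [g [Pg <-]]; exists (loop_concat f g); split.
    exact: concat_path Pf Pg.
  exact: cocycle_concat Pf Pg.
have SN v : S v -> S (- v).
  move=> [f [Pf <-]]; exists (rev_path f); split; first exact: rev_pathP.
  by apply: cocycle_rev => //; case: Pf.
have SM v n : S v -> S (v *~ n).
  move=> Sv; have SMn k : S (v *+ k) by elim: k => [|k IH] //; rewrite mulrS; exact: SD.
  by case: n => n; [exact: SMn|rewrite NegzE mulrNz; exact/SN/SMn].
have /choice [gam gamP] : forall x, exists f : Delta1 R -> X, is_path e x f by move=> x; exact: (pc e x).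
pose g x := phi (gam x).
(* The loop runs along [gam] to the start of [f], along [f], and back to [e] along the reverse of
   [gam]. *)
have Ss f : continuous f -> S (g (f (i0 R)) + phi f - g (f (i1 R))).
  move=> cf; have Pf : is_path (f (i0 R)) (f (i1 R)) f by [].
  have P1 := concat_path (gamP _) Pf; have P2 := rev_pathP (gamP (f (i1 R))).
  exists (loop_concat (loop_concat (gam (f (i0 R))) f) (rev_path (gam (f (i1 R))))); split.
    exact: concat_path P1 P2.
  rewrite (cocycle_concat co P1 P2) (cocycle_concat co (gamP _) Pf) cocycle_rev //.
  by case: (gamP (f (i1 R))).
have Sc c : sing_chain c -> S (csum phi c - csum g (bd1 c)).
  elim: c => [|p c IH] sc; first by rewrite /csum /bd1 !big_nil subr0.
  have {}IH : S (csum phi c - csum g (bd1 c)).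
    by apply: IH => q qc; apply: sc; rewrite inE qc orbT.
  have cp : continuous p.2 by apply: sc; rewrite inE eqxx.
  have := SD _ _ (SM _ p.1 (Ss _ cp)) IH; congr S.
  rewrite /csum /bd1 /= !big_cons /= mulrNz mulrzBl mulrzDl_tmp !opprD opprK.
  by rewrite [RHS](AC (2*(1*2)) (4*1*3*(2*5))).
move=> a; have [Pc ba] := H1_rep_cycle a.
have [f [Pf fa]] := Sc _ Pc.
exists (pcl Pf); apply: H1_val_inj; rewrite H1_val_hurewicz_pcl fa.
by rewrite (@csum_ev0 A X g) ?subr0.
Qed.

Lemma pi1_mulE (Y : topologicalType) (y : Y) (a b : pi1 R y) : pi1_mul a b = hmul a b.
Proof. by rewrite /pi1_mul /pi1_cls (clsE _ (concat_path (repP a) (repP b))). Qed.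

Lemma hurewicz_mul (e : X) (a b : pi1 R e) :
  hurewicz (pi1_mul a b) = H1_add (hurewicz a) (hurewicz b).
Proof.
apply: H1_val_inj; rewrite H1_val_add pi1_mulE.
have [f [Pf ->]] := homP a; have [g [Pg ->]] := homP b.
by rewrite hmul_pcl !H1_val_hurewicz_pcl; exact: cocycle_concat Pf Pg.
Qed.
End HomologyClasses.

(** * Topology of the James construction *)

Section JamesBasics.
Context {X : topologicalType} {e : X}.
Local Notation James := (James e).
Local Notation J_pre := {n : nat & {ptws 'I_n -> X}}.
Implicit Types (s : seq X) (w : James) (u : J_pre).

(** The reduced word, which by [word_pi] does not depend on the representative. Its counterpart [jl]
    also accepts lists containing [e]. *)
Definition word w : seq X := jword e (repr w).

Definition jl s : James :=
  \pi_James (existT (fun n => {ptws 'I_n -> X}) (size s) (fun i => nth e s i)).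

Lemma word_pi u : word (\pi_James u) = jword e u.
Proof.
have := reprK (\pi_James u); set v := repr _ => uv.
by have /eqP := introT (eqmodP (jequiv e) v u) uv.
Qed.

Lemma word_inj : injective word.
Proof.
move=> w w' ww'; rewrite -[w]reprK -[w']reprK.
by apply: (elimT (eqmodP (jequiv e) _ _)); apply/eqP; exact: ww'.
Qed.

Lemma word_jl s : word (jl s) = [seq x <- s | x != e].
Proof.
have sE : [seq nth e s i | i : 'I_(size s) <- enum 'I_(size s)] = s.
  by rewrite (map_comp (nth e s) (val : 'I_(size s) -> nat)) val_enum_ord -[RHS](mkseq_nth e).
by rewrite word_pi /jword /= sE.
Qed.

Lemma jlK w : jl (word w) = w.
Proof.
apply: word_inj; rewrite word_jl; apply/all_filterP.
by rewrite /word /jword filter_all.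
Qed.

Lemma jl_filter s : jl [seq x <- s | x != e] = jl s.
Proof. by apply: word_inj; rewrite !word_jl filter_id. Qed.

Lemma pi_jl u : \pi_James u = jl [seq projT2 u i | i <- enum 'I_(projT1 u)].
Proof. by apply: word_inj; rewrite word_pi word_jl. Qed.

Lemma jsigma_jl x : jsigma e x = jl [:: x].
Proof.
apply: word_inj; rewrite word_jl word_pi /jword /= enum_ordSl /=.
by case: (enum 'I_0) (size_enum_ord 0).
Qed.

Lemma base_jl : jsigma e e = jl [::].
Proof. by apply: word_inj; rewrite jsigma_jl !word_jl /= eqxx. Qed.

Lemma open_James (U : set James) : open U <->
  forall n, open [set x : {ptws 'I_n -> X} | U (jl [seq x i | i <- enum 'I_n])].
Proof.
split=> [oU n|oU].
  have /sigT_openP /(_ n) := oU.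
  by congr open; apply/seteqP; split=> x /=; rewrite /preimage /= pi_jl.
apply/sigT_openP => n; have := oU n.
by congr open; apply/seteqP; split=> x /=; rewrite /preimage /= pi_jl.
Qed.

Lemma cont_to_ptws (Z : topologicalType) n (f : Z -> {ptws 'I_n -> X}) z :
  (forall i, {for z, continuous (fun z => f z i)}) -> {for z, continuous f}.
Proof.
move=> cf; apply/cvg_sup => i B [_ /= [[C oC <-] Cfu] sB].
have /cf nC : nbhs (f z i) C by exact: open_nbhs_nbhs.
by apply: (@filterS _ (nbhs z) _ _ _ _ nC) => x Cx; apply: sB.
Qed.

(** The map factors through a power of [X], its injection into the disjoint union, and the quotient
    map. *)
Lemma cont_jl (Z : topologicalType) (T : eqType) (I : seq T) (F : T -> Z -> X) z :
  (forall i, i \in I -> {for z, continuous (F i)}) ->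
  {for z, continuous (fun z => jl [seq F i z | i <- I])}.
Proof.
case: I => [|i0 I] cF; first exact: cst_continuous.
set s := i0 :: I in cF *.
rewrite (_ : (fun z => _) = \pi_James \o existT (fun n => {ptws 'I_n -> X}) (size s)
    \o (fun z => (fun i : 'I_(size s) => F (nth i0 s i) z) : {ptws 'I_(size s) -> X})); last first.
  apply/funext => y; rewrite /= pi_jl /=; congr jl.
  rewrite (map_comp (fun i => F (nth i0 s i) y) (val : 'I_(size s) -> nat)) val_enum_ord.
  by rewrite -[LHS]/(map (F^~ y) s) -[in LHS](mkseq_nth i0 s) -map_comp.
have cf : {for z, continuous
    (fun z => (fun i : 'I_(size s) => F (nth i0 s i) z) : {ptws 'I_(size s) -> X})}.
  by apply: cont_to_ptws => i; apply: cF; rewrite mem_nth.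
apply: (@continuous_comp _ _ _ _ (\pi_James \o existT (fun n => {ptws 'I_n -> X}) (size s)) _ cf).
apply: (@continuous_comp _ _ _ (existT (fun n => {ptws 'I_n -> X}) (size s)) \pi_James).
  exact: existT_continuous.
exact: pi_continuous.
Qed.

Lemma cont_jsigma : continuous (jsigma e).
Proof.
rewrite (funext jsigma_jl) => x.
by apply: (@cont_jl X unit [:: tt] (fun _ => id)) => i _; exact: cvg_id.
Qed.

(* The tube lemma over a compact parameter interval replaces the fact that the product
   of a quotient map with an interval is a quotient map. *)
Lemma cont_jmap (R : realType) (h : X -> R -> X) :
  continuous (fun p : X * R => h p.1 p.2) -> (forall t, h e t = e) ->
  continuous (fun p : James * R => jl [seq h x p.2 | x <- word p.1]).
Proof.
move=> ch he; apply/continuousP => O oO; rewrite openE => -[w0 t0] /= Ow.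
pose G (x : seq X) t := jl [seq h y t | y <- x].
(* As [h] fixes [e], reducing a word before applying [h] changes nothing, so unreduced tuples may be
   used. *)
have GE s t : G (word (jl s)) t = G s t.
  rewrite /G word_jl -[LHS]jl_filter -[RHS]jl_filter; congr jl.
  rewrite !filter_map -filter_predI; congr map; apply: eq_filter => x /=.
  by case: (x =P e) => [->|_]; rewrite ?he ?eqxx ?andbT.
have cG n (x : {ptws 'I_n -> X}) t : {for (t, x), continuous
   (fun p : R * {ptws 'I_n -> X} => G [seq p.2 i | i <- enum 'I_n] p.1)}.
  have -> : (fun p : R * {ptws 'I_n -> X} => G [seq p.2 i | i <- enum 'I_n] p.1) =
      fun p => jl [seq h (p.2 i) p.1 | i <- enum 'I_n].
    by apply/funext => p; rewrite /G -map_comp.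
  apply: (@cont_jl _ _ _ (fun i (p : R * {ptws 'I_n -> X}) => h (p.2 i) p.1)) => i _.
  have cp : continuous (fun p : R * {ptws 'I_n -> X} => (p.2 i, p.1)).
    have ci : continuous (fun x : {ptws 'I_n -> X} => x i) by exact: proj_continuous.
    by apply: contpair; [exact: (contcomp (@cont_snd _ _) ci)|exact: cont_fst].
  exact: (contcomp cp ch).
have cG0 : {for t0, continuous (G (word w0))}.
  apply: (@cont_jl _ _ _ (fun y t => h y t)) => y _.
  have cp : continuous (fun t : R => (y, t)) by cont.
  exact: (contcomp cp ch).
have /nbhs_ballP [d /= d0 dO] : nbhs t0 (G (word w0) @^-1` O).
  by apply: cG0; exact: open_nbhs_nbhs.
pose K : set R := `[t0 - d / 2, t0 + d / 2]%classic.
(* The tube: words that stay in [O] for all times in the compact interval [K]. Openness is tested on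
   each power of [X]. *)
pose V := [set w | K `<=` [set t | O (G (word w) t)]].
have oV : open V.
  apply/open_James => n; rewrite openE => x0 /= Vx; rewrite /interior /=.
  have cK := (compact_near_coveringP K).1 (@segment_compact R _ _).
  have hK t : K t -> \forall t' \near t & x \near x0, O (G [seq x i | i <- enum 'I_n] t').
    move=> Kt; apply: (cG n x0 t); apply: open_nbhs_nbhs; split => //.
    by have := Vx _ Kt; rewrite /= GE.
  have := cK _ (nbhs x0) (fun x t => O (G [seq x i | i <- enum 'I_n] t)) (nbhs_filter x0) hK.
  apply: filterS => x Hx t Kt; rewrite /= GE.
  exact: Hx.
have Vw0 : V w0.
  move=> t; rewrite /K /= in_itv /= => tK; apply: dO.
  by rewrite /ball /= ltr_distlC; apply/andP; split; lra.
have nK : nbhs t0 K.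
  apply/nbhs_ballP; exists (d / 2); first by rewrite /= divr_gt0.
  move=> t; rewrite /ball /= ltr_distlC => /andP [t1 t2].
  by rewrite /K /= in_itv /=; apply/andP; split; lra.
exists (V, K); first by split => //; exact: open_nbhs_nbhs.
by move=> [w t] [/= Vw Kt]; exact: Vw.
Qed.
End JamesBasics.

(** * Level functions and local lifts *)

Lemma near_all (Z : topologicalType) (T : eqType) (I : seq T) (P : T -> Z -> Prop) (z : Z) :
  (forall i, i \in I -> \forall z' \near z, P i z') ->
  \forall z' \near z, forall i, i \in I -> P i z'.
Proof.
elim: I => [|i I IH] H; first by apply: nearW.
have h1 := H i (mem_head _ _).
have h2 : \forall z' \near z, forall i, i \in I -> P i z'.
  by apply: IH => j jI; apply: H; rewrite inE jI orbT.
apply: (@filterS2 _ (nbhs z) _ _ _ _ _ h1 h2) => z' Pi PI j.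
by rewrite inE => /orP [/eqP ->|/PI].
Qed.

Lemma near_cont (Z Y : topologicalType) (f : Z -> Y) (z : Z) (O : set Y) :
  {for z, continuous f} -> open O -> O (f z) -> \forall z' \near z, O (f z').
Proof. by move=> cf oO Oz; apply: cf; exact: open_nbhs_nbhs. Qed.

(** Extending the inclusions of [X * {0}] and [{e} * [0,1]] into their union [A] yields a retraction
    [F]. Take [h] to be its first coordinate and [u] to be 1 minus its second coordinate at time 1:
    if [u x < 1], then [F] at [(x, 1)] is off the bottom, hence over [e]. *)
Lemma cofibration_retraction (R : realType) (X : topologicalType) (e : X) :
  cofibration_pt R e -> exists (u : X -> R) (h : X -> R -> X),
  [/\ continuous u, u e = 0, continuous (fun p : X * R => h p.1 p.2)
    & [/\ forall x, h x 0 = x, forall t, h e t = e & forall x, u x < 1 -> h x 1 = e]].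
Proof.
pose A := [set p : X * Delta1 R | p.2 = i0 R \/ p.1 = e].
have Af x : (x, i0 R) \in A by rewrite inE; left.
have Ah t : (e, t) \in A by rewrite inE; right.
move=> /(_ (set_type A) (fun x => exist (fun p => p \in A) _ (Af x))
  (fun t => exist (fun p => p \in A) _ (Ah t))) [].
- by apply: cont_to_sub; have : continuous (fun x : X => (x, i0 R)) by cont.
- by apply: cont_to_sub; have : continuous (fun t : Delta1 R => (e, t)) by cont.
- exact: val_inj.
move=> F [cF F0 Fe].
exists (fun x => 1 - sval (sval (F (x, i1 R))).2), (fun x t => (sval (F (x, D1 t))).1).
split.
- by cont.
- by rewrite Fe /= subrr.
- by cont.
- split=> [x|t|x ux].
  + by rewrite D1_le0 // F0.
  + by rewrite Fe.
  + rewrite D1_ge1 //; have := svalP (F (x, i1 R)); rewrite inE => -[F2|//].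
    by move: ux; rewrite F2 /= subr0 ltxx.
Qed.

Section Letters.
Context {R : realType} {X : topologicalType} {e : X}.
Variables (u : X -> R) (cu : continuous u) (ue : u e = 0).
Local Notation James := (James e).

(** By continuity no letter crosses the level [c] near [z], so the set of selected indices is
    frozen. *)
Lemma filter_near (Z : topologicalType) (T : eqType) (I : seq T) (F : T -> Z -> X)
    (c : R) (z : Z) :
  (forall i, i \in I -> {for z, continuous (F i)}) ->
  (forall i, i \in I -> u (F i z) != c) ->
  \forall z' \near z, (forall i, i \in I -> u (F i z') != c) /\
    [seq x <- [seq F i z' | i <- I] | c < u x] =
    [seq F i z' | i <- [seq i <- I | c < u (F i z)]].
Proof.
move=> cF nc.
have : \forall z' \near z, forall i, i \in I ->
    u (F i z') != c /\ (c < u (F i z')) = (c < u (F i z)).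
  apply: near_all => i iI.
  have cuF : {for z, continuous (fun z => u (F i z))}.
    by apply: continuous_comp; [exact: cF|exact: cu].
  have := nc i iI; rewrite neq_lt => /orP [lt|gt].
    have := near_cont cuF (@open_lt R c) lt; apply: filterS => z' /= lt'.
    by rewrite lt_eqF // !ltNge (ltW lt) (ltW lt').
  have := near_cont cuF (@open_gt R c) gt; apply: filterS => z' /= gt'.
  by rewrite gt_eqF // gt gt'.
apply: filterS => z' H; split; first by move=> i /H [].
by rewrite filter_map; congr map; apply: eq_in_filter => i /H [].
Qed.

(** For [c > 0] the letter [e], of level 0, is never selected, so any unreduced list for [w] gives
    the same result. *)
Definition big_letters (c : R) (w : James) : seq X := [seq x <- word w | c < u x].

Lemma big_letters_jl c s : 0 < c -> big_letters c (jl s) = [seq x <- s | c < u x].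
Proof.
move=> c0; rewrite /big_letters word_jl -filter_predI; apply: eq_filter => x /=.
by case: (x =P e) => [->|]; rewrite ?ue ?andbT // ltNge (ltW c0).
Qed.

Lemma avoid_jl c s : 0 < c -> (forall x, x \in word (jl s : James) -> u x != c) <->
  (forall x, x \in s -> u x != c).
Proof.
move=> c0; split=> H x; last by rewrite word_jl mem_filter => /andP [_ /H].
have [->|xe] := eqVneq x e; first by rewrite ue lt_eqF.
by move=> xs; apply: H; rewrite word_jl mem_filter xe.
Qed.

(** With [O] the whole space this makes the number of big letters locally constant; with general [O]
    it gives continuity of the letter in position [i]. On a power of [X] the selected indices are
    locally constant and each letter is a projection. *)
Lemma open_letters (c : R) (k i : nat) (O : set X) : 0 < c -> open O ->
  open [set w : James | [/\ forall x, x \in word w -> u x != c,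
    size (big_letters c w) = k & (i < k)%N -> O (nth e (big_letters c w) i)]].
Proof.
move=> c0 oO; apply/open_James => n; rewrite openE => x0 /= [].
rewrite avoid_jl // big_letters_jl // => av sz Oi; rewrite /interior.
have cproj (j : 'I_n) (x : {ptws 'I_n -> X}) :
    {for x, continuous (fun x : {ptws 'I_n -> X} => x j)}.
  exact: proj_continuous.
have nF := @filter_near {ptws 'I_n -> X} _ (enum 'I_n) (fun j x => x j) c x0
  (fun j _ => cproj j x0) (fun j jn => av _ (map_f _ jn)).
have [_ E0] := nbhs_singleton nF.
set I := seq.filter _ _ in nF E0.
have szI : size I = k by rewrite -sz E0 size_map.
have nO : \forall x \near x0, (i < k)%N -> O (nth e [seq (x : {ptws 'I_n -> X}) j | j <- I] i).
  have [ik|] := ltnP i k; last first.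
    by move=> ki; apply: (@filterS _ (nbhs x0) _ _ _ _ nF) => x _.
  have j0 : 'I_n by move: szI ik; case: (I) => [<-|j0 ? _ _].
  have : \forall x \near x0, O ((x : {ptws 'I_n -> X}) (nth j0 I i)).
    apply: (near_cont (cproj (nth j0 I i) x0) oO).
    by have := Oi ik; rewrite E0 (nth_map j0) // szI.
  by apply: filterS => x Ox _; rewrite (nth_map j0) // szI.
apply: (@filterS2 _ (nbhs x0) _ _ _ _ _ nF nO) => x /= [av' E] Ox.
rewrite big_letters_jl // E size_map; split => //; rewrite avoid_jl // => y /mapP [j jn ->].
exact: av'.
Qed.

(* Near [z], the letters of [f z] above the level [c] move continuously, none is created
   or cancelled, and no letter crosses the level. *)
Definition tracks (Z : topologicalType) (f : Z -> James) (c : R) (L : seq (Z -> X)) (z : Z) :=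
  [/\ forall l, l \in L -> {for z, continuous l},
      big_letters c (f z) = [seq l z | l <- L]
    & forall x, x \in word (f z) -> u x != c].

(** The local lift consists of the functions reading off the big letters of [f z] by position. *)
Lemma tracks_near (Z : topologicalType) (f : Z -> James) (c : R) (z0 : Z) :
  continuous f -> 0 < c -> (forall x, x \in word (f z0) -> u x != c) ->
  exists L, \forall z \near z0, tracks f c L z.
Proof.
move=> cf c0 av; pose k := size (big_letters c (f z0)).
exists [seq (fun z => nth e (big_letters c (f z)) i) | i <- iota 0 k].
have := near_cont (cf z0) (@open_letters c k k setT c0 openT) (And3 av erefl (fun _ => I)).
apply: filterS => z /= [avz sz _]; split => //; last first.
  by rewrite -map_comp /= -sz; symmetry; apply: mkseq_nth.
move=> l /mapP [i]; rewrite mem_iota /= add0n => ik ->.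
move=> B; rewrite nbhsE => -[O [oO Oz] sO].
have := near_cont (cf z) (@open_letters c k i O c0 oO) (And3 avz sz (fun _ => Oz)).
by apply: filterS => z' /= [_ _ Oz']; apply: sO; exact: Oz'.
Qed.

(** Bisection: for each letter, pass to an open half of the interval that misses its level. *)
Lemma avoid_level (s : seq X) (a b : R) : a < b ->
  exists c, a < c < b /\ forall x, x \in s -> u x != c.
Proof.
elim: s a b => [|x s IH] a b ab; first by exists ((a + b) / 2); split => //; lra.
have [ux|ux] := leP (u x) ((a + b) / 2).
  have [|c [cab cs]] := IH ((a + b) / 2) b; first by lra.
  exists c; split; first by lra.
  by move=> y; rewrite inE => /orP [/eqP ->|/cs //]; rewrite lt_eqF //; lra.
have [|c [cab cs]] := IH a ((a + b) / 2); first by lra.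
exists c; split; first by lra.
by move=> y; rewrite inE => /orP [/eqP ->|/cs //]; rewrite gt_eqF //; lra.
Qed.

(** The discarded letters have level at most [c < 1], so [k] sends them to [e] and they disappear
    from the word. *)
Lemma jl_big_letters (k : X -> X) (c : R) (w : James) :
  (forall x, u x < 1 -> k x = e) -> c < 1 ->
  jl [seq k x | x <- word w] = jl [seq k x | x <- big_letters c w] :> James.
Proof.
move=> ku c1; rewrite /big_letters -jl_filter -[RHS]jl_filter; congr jl.
elim: (word w) => //= x s ->; case: (ltP c (u x)) => //= ux.
by rewrite ku ?eqxx // (le_lt_trans ux).
Qed.

End Letters.

(** * The fundamental group of the James construction *)

(** This plays the role of a Lebesgue subdivision: the supremum of the points reached from [a] can
    be passed unless it is [b]. *)
Lemma interval_induction (R : realType) (P : R -> R -> Prop) (a b : R) : a <= b ->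
  (forall x y z, a <= x -> x <= y -> y <= z -> z <= b -> P x y -> P y z -> P x z) ->
  (forall t, a <= t <= b -> exists2 d, 0 < d & forall x y, a <= x -> x <= y -> y <= b ->
     t - d < x -> y < t + d -> P x y) -> P a b.
Proof.
move=> ab PD Ploc.
pose S := [set x | a <= x <= b /\ P a x].
have Sa : S a.
  split; first by lra.
  by have [|d d0 Pd] := Ploc a; [lra|apply: Pd; lra].
have hS : has_sup S by split; [exists a|exists b => x [/andP []]].
have sS x : S x -> x <= sup S by move=> Sx; exact: ub_le_sup hS.2 _ Sx.
have as_ : a <= sup S by exact: sS.
have sb : sup S <= b by apply: ge_sup => [|x [/andP []] //]; exists a.
have [|d d0 Pd] := Ploc (sup S); first by lra.
have [x [xab Pax] xs] := sup_adherent d0 hS.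
have xle : x <= sup S by apply: sS.
have Pay y : x <= y -> y <= b -> y < sup S + d -> P a y.
  by move=> xy yb yd; apply: (PD a x y); [lra|lra|lra|lra|by []|apply: Pd; lra].
have [sb'|] := ltP (sup S) b; last by move=> bs; apply: Pay; lra.
(* If [sup S < b], this point lies beyond the supremum and still belongs to [S], a contradiction. *)
pose y := Num.min b (sup S + d / 2).
have yb : y <= b by rewrite /y; mm; lra.
have ys : sup S < y by rewrite /y; mm; lra.
have /sS : S y.
  by split; [lra|apply: Pay => //; [lra|rewrite /y; mm; lra]].
by lra.
Qed.

(** * The image of [sigma_sharp] *)

Section SigmaHom.
Context {R : realType} {X : topologicalType} {e : X}.
Local Notation base := (jsigma e e).
Local Notation James := (James e).

Lemma jsigma_path x y (f : Delta1 R -> X) : is_path x y f ->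
  is_path (jsigma e x) (jsigma e y) (jsigma e \o f).
Proof.
case=> cf <- <-; split => //; exact: (contcomp cf (@cont_jsigma X e)).
Qed.

Lemma sigma_pcl (f : Delta1 R -> X) (Pf : is_path e e f) :
  sigma_sharp (pcl Pf : pi1 R e) = pcl (jsigma_path Pf).
Proof.
have Pr := repP (pcl Pf); have cs := @cont_jsigma X e.
rewrite /sigma_sharp /pi1_cls (clsE _ (jsigma_path Pr)).
apply/(pcl_eq (jsigma_path Pr) (jsigma_path Pf)).
have [H [cH H0 H1 Hs]] := pcl_rep_htpy Pf.
exists (fun p => jsigma e (H p)); split => [|t|t|s].
- exact: (contcomp cH cs).
- by rewrite H0.
- by rewrite H1.
- by rewrite (Hs s).1 (Hs s).2.
Qed.

Lemma sigma_mul (a b : hom e e) : sigma_sharp (hmul a b : pi1 R e) =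
  hmul (sigma_sharp (a : pi1 R e) : hom base base) (sigma_sharp (b : pi1 R e)).
Proof.
have [f [Pf ->]] := homP a; have [g [Pg ->]] := homP b.
rewrite hmul_pcl !sigma_pcl hmul_pcl; apply/pcl_eq.
rewrite (_ : jsigma e \o loop_concat f g = loop_concat (jsigma e \o f) (jsigma e \o g)).
  exact/htpy_refl/(concat_path (jsigma_path Pf) (jsigma_path Pg)).
by apply/funext => t; rewrite /loop_concat /=; case: ifP.
Qed.

Lemma jl_ext (s s' : seq X) : [seq x <- s | x != e] = [seq x <- s' | x != e] ->
  jl s = jl s' :> James.
Proof. by move=> ss; rewrite -jl_filter ss jl_filter. Qed.

Lemma jl_nil (T : Type) (I : seq T) (F : T -> X) : (forall i, F i = e) ->
  jl [seq F i | i <- I] = base.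
Proof.
by move=> Fe; rewrite base_jl; apply: jl_ext; elim: I => //= i I ->; rewrite Fe eqxx.
Qed.

Lemma cont_jl_fun (Z : topologicalType) (fs : seq (Z -> X)) :
  (forall f, f \in fs -> continuous f) -> continuous (fun z => jl [seq f z | f <- fs] : James).
Proof. by move=> cf z; apply: (@cont_jl _ e Z _ fs id) => f /cf; apply. Qed.

(** The square sending [(s, t)] to the two-letter word [f s], [g t] has [f] on its horizontal sides
    and [g] on its vertical ones. *)
Lemma sigma_comm (a b : hom e e) :
  hmul (sigma_sharp (a : pi1 R e) : hom base base) (sigma_sharp (b : pi1 R e)) =
  hmul (sigma_sharp (b : pi1 R e) : hom base base) (sigma_sharp (a : pi1 R e)).
Proof.
have [f [Pf ->]] := homP a; have [g [Pg ->]] := homP b; rewrite !sigma_pcl.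
have [cf f0 f1] := Pf; have [cg g0 g1] := Pg.
pose F (p : R * R) : James :=
  jl [seq k p | k <- [:: (fun p => f (D1 p.1)); (fun p => g (D1 p.2))]].
have cF : continuous F.
  by apply: cont_jl_fun => k; rewrite !inE => /orP [] /eqP ->; cont.
have [] := @hmul_square R James F _ _ _ _ (fun t => F (sval t, sval t)) _ _ _ _
  (jsigma_path Pf) (jsigma_path Pg) (jsigma_path Pf) (jsigma_path Pg) cF.
- by move=> t; rewrite /= jsigma_jl; apply: jl_ext; rewrite /= D1K D1_le0 // g0 eqxx.
- by move=> t; rewrite /= jsigma_jl; apply: jl_ext; rewrite /= D1K D1_ge1 // f1 eqxx.
- by move=> t; rewrite /= jsigma_jl; apply: jl_ext; rewrite /= D1K D1_ge1 // g1 eqxx.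
- by move=> t; rewrite /= jsigma_jl; apply: jl_ext; rewrite /= D1K D1_le0 // f0 eqxx.
- by [].
- by move=> Pd [<- <-].
Qed.

Definition in_sigma (a : hom base base) := exists b : pi1 R e, sigma_sharp b = a.

Lemma in_sigma_mul a b : in_sigma a -> in_sigma b -> in_sigma (hmul a b).
Proof. by move=> [c <-] [d <-]; exists (hmul c d : hom e e); exact: sigma_mul. Qed.

(* The diagonal of the square sending [(s, t)] to the letter [a i s] followed by the letters
   [a j t], for [j] in [I], is homotopic to two consecutive sides of that square. *)
Lemma in_sigma_pointwise (T : eqType) (I : seq T) (a : T -> Delta1 R -> X)
    (P : is_path base base (fun t => jl [seq a i t | i <- I])) :
  (forall i, i \in I -> is_path e e (a i)) -> in_sigma (pcl P).
Proof.
elim: I P => [|i I IH] P Pa.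
  exists (hone e : pi1 R e); rewrite (sigma_pcl (cst_path e)); apply/pcl_eq.
  rewrite (_ : jsigma e \o _ = fun t => jl [seq a i t | i <- [::]]); first exact: htpy_refl.
  by apply/funext => t /=; rewrite base_jl.
have PI j : j \in I -> is_path e e (a j) by move=> jI; apply: Pa; rewrite inE jI orbT.
have Pi : is_path e e (a i) by apply: Pa; rewrite inE eqxx.
have [ci i0E i1E] := Pi.
pose F (p : R * R) : James :=
  jl [seq k p | k <- (fun p => a i (D1 p.1)) :: [seq (fun p => a j (D1 p.2)) | j <- I]].
have FE p : F p = jl (a i (D1 p.1) :: [seq a j (D1 p.2) | j <- I]) by rewrite /F /= -map_comp.
have eI (t : Delta1 R) : (t = i0 R \/ t = i1 R) -> [seq x <- [seq a j t | j <- I] | x != e] = [::].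
  move=> t01; elim: (I) PI => //= j I' IH' PI.
  have [_ j0 j1] := PI _ (mem_head _ _).
  have -> : a j t = e by case: t01 => ->.
  by rewrite eqxx IH' // => k kI; apply: PI; rewrite inE kI orbT.
have cF : continuous F.
  apply: cont_jl_fun => k; rewrite inE => /orP [/eqP ->|/mapP [j jI ->]]; first by cont.
  by have [cj _ _] := PI _ jI; cont.
pose q (t : Delta1 R) : James := jl [seq a j t | j <- I].
have Pq : is_path base base q.
  split; last 2 first.
  - by rewrite base_jl; apply: jl_ext; rewrite eI //; left.
  - by rewrite base_jl; apply: jl_ext; rewrite eI //; right.
  by move=> t; apply: cont_jl => j jI; have [cj _ _] := PI _ jI; exact: cj.
have [] := @hmul_square R James F _ _ _ _ (fun t => jl [seq a j t | j <- i :: I]) _ _ _ _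
  (jsigma_path Pi) Pq (jsigma_path Pi) Pq cF.
- move=> t; rewrite /= jsigma_jl FE /= D1K; apply: jl_ext => /=.
  by rewrite eI //; left; rewrite D1_le0.
- by move=> t; rewrite /= FE /= D1K D1_ge1 // i1E; apply: jl_ext; rewrite /= eqxx.
- move=> t; rewrite /= jsigma_jl FE /= D1K; apply: jl_ext => /=.
  by rewrite eI //; right; rewrite D1_ge1.
- by move=> t; rewrite /= FE /= D1K D1_le0 // i0E; apply: jl_ext; rewrite /= eqxx.
- by move=> t; rewrite FE /= D1K.
move=> Pd [e1 _]; rewrite (Prop_irrelevance P Pd) e1; apply: in_sigma_mul; last exact: IH.
by exists (pcl Pi : pi1 R e); rewrite sigma_pcl.
Qed.

End SigmaHom.

(** * Surjectivity of [sigma_sharp] and the induced cocycle *)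

Section SigmaSurjective.
Context {R : realType} {X : topologicalType} {e : X}.
Local Notation base := (jsigma e e).
Local Notation James := (James e).
Local Notation hom := (@hom R _).
Variables (u : X -> R) (h : X -> R -> X).
Hypotheses (cu : continuous u) (ue : u e = 0)
  (ch : continuous (fun p : X * R => h p.1 p.2))
  (h0 : forall x, h x 0 = x) (he : forall t, h e t = e)
  (h1 : forall x, u x < 1 -> h x 1 = e).
Variable gam : X -> Delta1 R -> X.
Hypotheses (gamP : forall x, is_path e x (gam x)) (game : forall t, gam e t = e).

(** A letterwise path from the empty word to [w]. Since [gam e] is constant, it can be computed from
    unreduced lists as well. *)
Definition jgam (w : James) : Delta1 R -> James := fun t => jl [seq gam x t | x <- word w].

Lemma jgam_jl s t : jgam (jl s) t = jl [seq gam x t | x <- s].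
Proof.
rewrite /jgam word_jl; apply: jl_ext; elim: s => //= x s IH.
by case: (x =P e) => [->|_] /=; rewrite ?game ?eqxx IH.
Qed.

Lemma jgamP w : is_path base w (jgam w).
Proof.
split.
- by move=> t; apply: cont_jl => x _; case: (gamP x) => cg _ _; exact: cg.
- by apply: jl_nil => x; case: (gamP x).
- rewrite /jgam -[RHS]jlK; congr jl; rewrite -[RHS]map_id; apply: eq_map => x.
  by case: (gamP x).
Qed.

(** Membership in the image of [sigma_sharp] thereby makes sense for a piece of a loop, and it is
    compatible with cutting because the connecting paths cancel. *)
Definition close_up w w' (s : hom w w') : hom base base :=
  hmul (pcl (jgamP w)) (hmul s (hinv (pcl (jgamP w')))).

Lemma close_up_mul w w' w'' (s : hom w w') (s' : hom w' w'') :
  hmul (close_up s) (close_up s') = close_up (hmul s s').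
Proof. by rewrite /close_up -!hmulA hmulKV. Qed.

Lemma close_up_base (s : hom base base) : close_up s = s.
Proof.
rewrite /close_up; have -> : pcl (jgamP base) = hone base.
  apply/pcl_eq; rewrite (_ : jgam base = fun=> base); first exact/htpy_refl/cst_path.
  by apply/funext => t; rewrite base_jl jgam_jl.
by rewrite hmul1l -[X in hmul X _]hmul1r -hmulA hmulV hmul1r.
Qed.

(** The endpoints of a segment equal the base point only propositionally; keeping them variable
    allows substitution in the dependent types. *)
Lemma in_sigma_close_up w w' f (P : is_path w w' f) : w = base -> w' = base ->
  in_sigma (close_up (pcl P)) -> forall P' : is_path base base f, in_sigma (pcl P').
Proof.
move=> ew ew'; subst w w'; rewrite close_up_base => i P'.
by rewrite (Prop_irrelevance P' P).
Qed.

Lemma jl_concat (T : Type) (I : seq T) (F G : T -> Delta1 R -> X) :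
  loop_concat (fun t => jl [seq F i t | i <- I] : James) (fun t => jl [seq G i t | i <- I]) =
  fun t => jl [seq loop_concat (F i) (G i) t | i <- I].
Proof. by apply/funext => t; rewrite /loop_concat; case: ifP. Qed.

(** Concatenation commutes with forming words, so closing up a lifted path closes up every letter
    into a loop at [e], and [in_sigma_pointwise] applies. *)
Lemma in_sigma_close_up_lift (T : eqType) (I : seq T) (m : T -> Delta1 R -> X) w w'
    (s : Delta1 R -> James) (P : is_path w w' s) :
  (forall i, i \in I -> continuous (m i)) ->
  (forall t, s t = jl [seq m i t | i <- I]) -> in_sigma (close_up (pcl P)).
Proof.
move=> cm sE; rewrite /close_up hinv_pcl !hmul_pcl.
set Pc := concat_path _ _.
have [_ s0 s1] := P.
have fE : loop_concat (jgam w) (loop_concat s (rev_path (jgam w'))) =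
  fun t => jl [seq loop_concat (gam (m i (i0 R)))
    (loop_concat (m i) (rev_path (gam (m i (i1 R))))) t | i <- I].
  rewrite -jl_concat; congr loop_concat.
    by apply/funext => t; rewrite -s0 sE jgam_jl -map_comp.
  rewrite -jl_concat; congr loop_concat; first exact/funext.
  by apply/funext => t; rewrite /rev_path -s1 sE jgam_jl -map_comp.
clearbody Pc; move: Pc; rewrite fE => Pc.
apply: in_sigma_pointwise => i iI.
have Pm : is_path (m i (i0 R)) (m i (i1 R)) (m i) by split => //; exact: cm.
exact: concat_path (gamP _) (concat_path Pm (rev_pathP (gamP _))).
Qed.

Lemma sigma_surj (a : hom base base) : in_sigma a.
Proof.
have [f [Pf ->]] := homP a; have [cf f0 f1] := Pf.
pose K (p : James * R) : James := jl [seq h x p.2 | x <- word p.1].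
have cK : continuous K by exact: cont_jmap.
pose fR (t : R) := f (D1 t).
have cfR : continuous fR by rewrite /fR; cont.
pose p (t : R) : James := K (fR t, 1).
have cp : continuous p by rewrite /p; cont.
have Kbase t : K (base, t) = base by rewrite /K /= base_jl word_jl.
have p0 : p 0 = base by rewrite /p /fR D1_le0 // f0 Kbase.
have p1 : p 1 = base by rewrite /p /fR D1_ge1 // f1 Kbase.
have P01 : is_path base base (seg p 0 1) by rewrite -{1}p0 -p1; exact: segP.
(* The deformation [K] fixes the base point, so the loop may be replaced by its image at time 1. *)
have -> : pcl Pf = pcl P01.
  apply/pcl_eq; exists (fun q => K (f q.1, sval q.2)); split.
  - have cq : continuous (fun q : Delta1 R * Delta1 R => (f q.1, sval q.2)) by cont.
    exact: (contcomp cq cK).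
  - move=> t; rewrite /K /= -[RHS]jlK; congr jl; rewrite -[RHS]map_id.
    by apply: eq_map => x.
  - by move=> t; rewrite /seg /p /fR subr0 mulr1 add0r D1K.
  - by move=> s; rewrite /= f0 f1 Kbase.
apply: (in_sigma_close_up (P := segP 0 1 cp)) => //.
apply: (@interval_induction R (fun x y => in_sigma (close_up (pcl (segP x y cp))))) => //.
  move=> x y z _ _ _ _ Pxy Pyz.
  by rewrite -(hmul_seg cp x y z) -close_up_mul; exact: in_sigma_mul.
move=> t _; have [c [c01 av]] := avoid_level u (word (fR t)) (@ltr01 R).
have c0 : 0 < c by lra.
have [L] := tracks_near cu ue cfR c0 av.
rewrite -nbhs_nearE => /nbhs_ballP [d /= d0 tL]; exists d => // x y _ xy _ tx ty.
have tr s : x <= s -> s <= y -> tracks u fR c L s.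
  by move=> xs sy; apply: tL; rewrite /ball /= ltr_distlC; apply/andP; split; lra.
(* The lift takes the letters above the level [c], pushed by the final map of [h]; that map erases
   all the others. *)
apply: (@in_sigma_close_up_lift (R -> X) L (fun l s => h (l (x + sval s * (y - x))) 1)).
  move=> l lL s; have := sval01 s => s01.
  have [cl _ _] : tracks u fR c L (x + sval s * (y - x)) by apply: tr; nra.
  have cs : continuous (fun s : Delta1 R => x + sval s * (y - x)) by cont.
  have chx : continuous (fun z => h z 1).
    have cz : continuous (fun z : X => (z, 1 : R)) by cont.
    exact: (contcomp cz ch).
  have cls : {for s, continuous (fun s : Delta1 R => l (x + sval s * (y - x)))}.
    exact: (continuous_comp (cs s) (cl l lL)).
  exact: (continuous_comp cls (chx _)).
move=> s; have := sval01 s => s01; rewrite /seg /p /K /=.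
set r := x + _.
have [_ lE _] : tracks u fR c L r by apply: tr; rewrite /r; nra.
rewrite (@jl_big_letters R X e u (h^~ 1) c) //; last by lra.
by rewrite lE -map_comp.
Qed.

Definition close_upX x y (a : hom x y) : hom e e :=
  hmul (pcl (gamP x)) (hmul a (hinv (pcl (gamP y)))).

Lemma close_upX_mul x y z (a : hom x y) (b : hom y z) :
  hmul (close_upX a) (close_upX b) = close_upX (hmul a b).
Proof. by rewrite /close_upX -!hmulA hmulKV. Qed.

Lemma close_upX_e (a : hom e e) : close_upX a = a.
Proof.
rewrite /close_upX; have -> : pcl (gamP e) = hone e.
  apply/pcl_eq; rewrite (_ : gam e = fun=> e); first exact/htpy_refl/cst_path.
  by apply/funext => t; rewrite game.
by rewrite hmul1l -[X in hmul X _]hmul1r -hmulA hmulV hmul1r.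
Qed.

Lemma hmul_comm (a b : hom base base) : hmul a b = hmul b a.
Proof.
have [c <-] := sigma_surj a; have [d <-] := sigma_surj b.
exact: (@sigma_comm R X e c d).
Qed.

(* The fundamental group of [James e] being abelian, closing up the paths of [X] along
   [gam] is a cocycle with values in it. *)
Lemma sigma_cocycle : exists (A : zmodType) (v : hom base base -> A)
    (psi : (Delta1 R -> X) -> A), [/\ injective v, cocycle psi &
  forall f (P : is_path e e f), psi f = v (sigma_sharp (pcl P : pi1 R e))].
Proof.
pose T := hom base base.
pose CT : choiceType := T.
have mA : associative (@hmul R _ base base base : CT -> CT -> CT) by exact: hmulA.
have mC : commutative (@hmul R _ base base base : CT -> CT -> CT) by exact: hmul_comm.
have m1 : left_id (hone base : CT) (@hmul R _ base base base) by exact: hmul1l.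
have mV : left_inverse (hone base : CT) (@hinv R _ base base) (@hmul R _ base base base).
  exact: hmulVl.
pose A : zmodType := HB.pack T (GRing.isZmodule.Build CT mA mC m1 mV).
(* A cocycle is a function on all maps, so discontinuous ones receive the dummy value 0. *)
pose psi (f : Delta1 R -> X) : A := match pselect (continuous f) with
  | left cf => sigma_sharp (close_upX (pcl (And3 cf erefl erefl :
        is_path (f (i0 R)) (f (i1 R)) f)) : pi1 R e)
  | right _ => 0
  end.
have psiE x y f (P : is_path x y f) : psi f = sigma_sharp (close_upX (pcl P) : pi1 R e).
  have [cf ex ey] := P; subst x y; rewrite /psi; case: pselect => // cf'.
  by rewrite (Prop_irrelevance (And3 _ _ _) P).
exists A, id, psi; split => //.
- move=> s cs; have [P2 [P0 [P1 e21]]] := hmul_triangle cs erefl erefl erefl.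
  rewrite (psiE _ _ _ P2) (psiE _ _ _ P0) (psiE _ _ _ P1) -e21 -close_upX_mul.
  by rewrite sigma_mul.
- by move=> f P; rewrite (psiE _ _ _ P) close_upX_e.
Qed.

End SigmaSurjective.

(** * Potentials *)

Section Boxes.
Context {R : realType}.
Implicit Types z w : R * R.

Definition box z0 (d : R) z :=
  [/\ z0.1 - d < z.1, z.1 < z0.1 + d, z0.2 - d < z.2 & z.2 < z0.2 + d].

Definition sp z w (t : R) : R * R := (z.1 + t * (w.1 - z.1), z.2 + t * (w.2 - z.2)).

Lemma nbhs_box z0 (P : set (R * R)) :
  nbhs z0 P -> exists2 d, 0 < d & forall z, box z0 d z -> P z.
Proof.
move=> /nbhs_ballP [d /= d0 H]; exists d => // z [z1 z2 z3 z4]; apply: H.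
by split; rewrite /= /ball /= ltr_distlC; apply/andP; split.
Qed.

Lemma box_nbhs z0 d : 0 < d -> nbhs z0 (box z0 d).
Proof.
move=> d0; apply/nbhs_ballP; exists d => // z [].
by rewrite /ball /= !ltr_distlC => /andP [? ?] /andP [? ?]; split.
Qed.

(** The point is the average of [x], [y], [v] with weights [1 - a - b], [a], [b]. Comparing with
    their minimum [n > m] keeps the inequality strict when some weights vanish. *)
Lemma conv3_gt (m x y v a b : R) : m < x -> m < y -> m < v ->
  0 <= a -> 0 <= b -> a + b <= 1 -> m < x + a * (y - x) + b * (v - x).
Proof.
move=> mx my mv a0 b0 ab; pose n := Num.min x (Num.min y v).
have mn : m < n by rewrite /n; mm.
have nx : n <= x by rewrite /n; mm; lra.
have ny : n <= y by rewrite /n; mm; lra.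
have nv : n <= v by rewrite /n; mm; lra.
have c0 : 0 <= 1 - a - b by lra.
have h1 : 0 <= (1 - a - b) * (x - n) by apply: mulr_ge0; lra.
have h2 : 0 <= a * (y - n) by apply: mulr_ge0; lra.
have h3 : 0 <= b * (v - n) by apply: mulr_ge0; lra.
have -> : x + a * (y - x) + b * (v - x) =
  n + (1 - a - b) * (x - n) + a * (y - n) + b * (v - n) by ring.
by move: h1 h2 h3; lra.
Qed.

Lemma conv3_lt (m x y v a b : R) : x < m -> y < m -> v < m ->
  0 <= a -> 0 <= b -> a + b <= 1 -> x + a * (y - x) + b * (v - x) < m.
Proof.
move=> mx my mv a0 b0 ab.
rewrite -ltrN2; have -> : - (x + a * (y - x) + b * (v - x)) =
  - x + a * (- y - - x) + b * (- v - - x) by ring.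
by apply: conv3_gt => //; lra.
Qed.

Lemma box_conv3 z0 d z w v a b : box z0 d z -> box z0 d w -> box z0 d v ->
  0 <= a -> 0 <= b -> a + b <= 1 ->
  box z0 d (z.1 + a * (w.1 - z.1) + b * (v.1 - z.1), z.2 + a * (w.2 - z.2) + b * (v.2 - z.2)).
Proof.
move=> [? ? ? ?] [? ? ? ?] [? ? ? ?] a0 b0 ab.
by split; rewrite /=; do [exact: conv3_gt | exact: conv3_lt].
Qed.

Lemma box_sp z0 d z w t : box z0 d z -> box z0 d w -> 0 <= t <= 1 -> box z0 d (sp z w t).
Proof.
move=> bz bw t01; have := @box_conv3 z0 d z w z t 0 bz bw bz.
by rewrite /sp !subrr !mulr0 !addr0; apply; lra.
Qed.

Lemma box_center z0 d : 0 < d -> box z0 d z0.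
Proof. by move=> d0; split; lra. Qed.

Lemma box_le z0 d d' z : d <= d' -> box z0 d z -> box z0 d' z.
Proof. by move=> dd [? ? ? ?]; split; lra. Qed.

Lemma box_sub z0 d z1 : box z0 d z1 ->
  exists2 d1, 0 < d1 & forall z, box z1 d1 z -> box z0 d z.
Proof.
move=> b1; have [h1 h2 h3 h4] := b1.
set a1 := z1.1 - (z0.1 - d); set a2 := z0.1 + d - z1.1.
set a3 := z1.2 - (z0.2 - d); set a4 := z0.2 + d - z1.2.
pose m := Num.min (Num.min a1 a2) (Num.min a3 a4).
have m1 : m <= a1 by rewrite !ge_min lexx.
have m2 : m <= a2 by rewrite !ge_min lexx orbT.
have m3 : m <= a3 by rewrite !ge_min lexx orbT.
have m4 : m <= a4 by rewrite !ge_min lexx !orbT.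
exists m; first by rewrite !lt_min !subr_gt0 h1 h2 h3.
by move=> z []; move: m1 m2 m3 m4; rewrite /a1 /a2 /a3 /a4 => *; split; lra.
Qed.

Lemma cont_sp z w : continuous (sp z w).
Proof. by rewrite /sp; cont. Qed.
End Boxes.

(** The point [t0] rules out lists of different lengths. *)
Lemma map_comp_eq (Z T X : Type) (fs gs : seq (Z -> X)) (p : T -> Z) (t0 : T) :
  (forall t, [seq f (p t) | f <- fs] = [seq g (p t) | g <- gs]) ->
  [seq (fun t => f (p t)) | f <- fs] = [seq (fun t => g (p t)) | g <- gs].
Proof.
elim: fs gs => [|f fs IH] [|g gs] H //=; try by have := H t0.
congr (_ :: _); first by apply/funext => t; have [] := H t.
by apply: IH => t; have [] := H t.
Qed.

Lemma cont_comp_at (T U V : topologicalType) (f : T -> U) (g : U -> V) (t : T) :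
  {for t, continuous f} -> continuous g -> {for t, continuous (fun t => g (f t))}.
Proof. by move=> cf cg; apply: continuous_comp => //; exact: cg. Qed.

Section Potentials.
Context {R : realType} {X : topologicalType} {e : X}.
Local Notation James := (James e).
Variables (u : X -> R) (k : X -> X).
Hypotheses (cu : continuous u) (ue : u e = 0) (ck : continuous k)
  (ku : forall x, u x < 1 -> k x = e).
Context {A : zmodType} (phi : (Delta1 R -> X) -> A) (co : cocycle phi).
Variables (f : R * R -> James) (cf : continuous f).
Implicit Types (z w : R * R) (L : seq (R * R -> X)) (c d : R).

(** The total value of [phi] on the letters of the local lift [L], pushed by [k], along the straight
    segment from [z] to [w]. *)
Definition increment L z w : A :=
  \sum_(l <- L) phi (fun t => k (l (sp z w (sval t)))).

Lemma increment_add c L z0 d x y z :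
  (forall z, box z0 d z -> tracks u f c L z) -> box z0 d x -> box z0 d y -> box z0 d z ->
  increment L x y + increment L y z = increment L x z.
Proof.
move=> tr bx by_ bz; rewrite /increment -big_split /= !big_seq; apply: eq_bigr => l lL.
apply: (cocycle_segx co (l := fun z => k (l z))) => a b a0 b0 ab.
set v := (_, _); have [cl _ _] : tracks u f c L v by apply: tr; exact: box_conv3.
exact: (@cont_comp_at _ _ _ l k _ (cl l lL) ck).
Qed.

(** Raising the level drops letters of level at most [c' < 1] at [z0]. Nearby they stay below 1, so
    [k] makes them constant and [phi] ignores them. *)
Lemma increment_le_level c c' L L' z0 d : 0 < d -> c <= c' -> c' < 1 ->
  (forall z, box z0 d z -> tracks u f c L z) ->
  (forall z, box z0 d z -> tracks u f c' L' z) ->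
  exists2 d', 0 < d' <= d & forall z w, box z0 d' z -> box z0 d' w ->
    increment L z w = increment L' z w.
Proof.
move=> d0 cc c1 tr tr'.
have [cL LE av] := tr z0 (box_center _ d0).
have [_ _ av'] := tr' z0 (box_center _ d0).
have nc l : l \in L -> u (l z0) != c'.
  move=> lL; apply: av'.
  have : l z0 \in [seq l z0 | l <- L] by apply/mapP; exists l.
  by rewrite -LE mem_filter => /andP [].
have nF := @filter_near R X u cu _ _ L (fun l z => l z) c' z0 cL nc.
have nS : \forall z \near z0, forall l, l \in L -> ~~ (c' < u (l z0)) -> u (l z) < 1.
  apply: near_all => l lL; have [_|ul] := ltP c' (u (l z0)).
    by apply: (@filterS _ (nbhs z0) _ _ _ _ nF) => z.
  have cul : {for z0, continuous (fun z => u (l z))} by exact: (@cont_comp_at _ _ _ l u _ (cL l lL) cu).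
  have : \forall z \near z0, u (l z) < 1.
    by apply: (near_cont cul (@open_lt R 1)); exact: le_lt_trans c1.
  by apply: filterS => z.
have [d1 d10 H1] := nbhs_box nF; have [d2 d20 H2] := nbhs_box nS.
exists (Num.min d (Num.min d1 d2)); first by mm; lra.
set d' := Num.min _ _ => z w bz bw.
have b1 y : box z0 d' y -> box z0 d1 y by apply: box_le; rewrite /d'; mm; lra.
have b2 y : box z0 d' y -> box z0 d2 y by apply: box_le; rewrite /d'; mm; lra.
have b3 y : box z0 d' y -> box z0 d y by apply: box_le; rewrite /d'; mm; lra.
rewrite /increment (bigID (fun l => c' < u (l z0))) /= [X in _ + X]big_seq_cond.
rewrite [X in _ + X]big1 ?addr0; last first.
  move=> l /andP [lL ul]; rewrite (_ : (fun t => _) = fun=> e) ?(cocycle_cst co) //.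
  apply/funext => t; apply: ku; apply: H2 => //; apply: b2.
  by apply: box_sp => //; exact: sval01.
rewrite -big_filter; set L'' := seq.filter _ _.
(* The lifts may differ away from the box, so they are compared only along the segment. *)
have E : [seq (fun t : Delta1 R => l (sp z w (sval t))) | l <- L''] =
    [seq (fun t : Delta1 R => l (sp z w (sval t))) | l <- L'].
  apply: (map_comp_eq (p := fun t : Delta1 R => sp z w (sval t)) (i0 R)) => t.
  have bt : box z0 d' (sp z w (sval t)) by apply: box_sp => //; exact: sval01.
  have [_ <-] := H1 _ (b1 _ bt).
  have [_ <- _] := tr _ (b3 _ bt); have [_ <- _] := tr' _ (b3 _ bt).
  rewrite /big_letters -filter_predI; apply: eq_filter => x /=.
  by rewrite andb_idr // => /(le_lt_trans cc).
have sumE M : \sum_(l <- M) phi (fun t => k (l (sp z w (sval t)))) =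
    \sum_(g <- [seq (fun t : Delta1 R => l (sp z w (sval t))) | l <- M]) phi (fun t => k (g t)).
  by rewrite big_map.
by rewrite !sumE E.
Qed.

Lemma increment_level c c' L L' z0 d : 0 < d -> c < 1 -> c' < 1 ->
  (forall z, box z0 d z -> tracks u f c L z) ->
  (forall z, box z0 d z -> tracks u f c' L' z) ->
  exists2 d', 0 < d' <= d & forall z w, box z0 d' z -> box z0 d' w ->
    increment L z w = increment L' z w.
Proof.
move=> d0 c1 c1' tr tr'; case: (leP c c') => cc.
  exact: increment_le_level cc c1' tr tr'.
have [d' hd' H] := increment_le_level d0 (ltW cc) c1 tr' tr.
by exists d' => // z w bz bw; rewrite H.
Qed.

Definition potential_at (D : set (R * R)) (F : R * R -> A) z0 c L d :=
  [/\ 0 < c < 1, 0 < d, forall z, box z0 d z -> tracks u f c L z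
    & forall z w, box z0 d z -> D z -> box z0 d w -> D w -> F w - F z = increment L z w].

Definition potential (D : set (R * R)) (F : R * R -> A) :=
  forall z0, D z0 -> exists c L d, potential_at D F z0 c L d.

Lemma potential_at_le D F z0 c L d d' :
  0 < d' <= d -> potential_at D F z0 c L d -> potential_at D F z0 c L d'.
Proof.
move=> /andP [d0 dd] [c01 _ tr H]; split => //.
  by move=> z bz; apply: tr; exact: box_le bz.
by move=> z w bz Dz bw Dw; apply: H => //; [exact: box_le bz|exact: box_le bw].
Qed.

(** On a box with one lift, the increment from the centre is a potential, by additivity. *)
Lemma local_potential z0 : exists2 d, 0 < d &
  forall D : set (R * R), (forall z, D z -> box z0 d z) -> exists F, potential D F.
Proof.
have [c [c01 av]] := avoid_level u (word (f z0)) (@ltr01 R).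
have c0 : 0 < c by lra.
have [L nL] := tracks_near cu ue cf c0 av; have [d d0 tr] := nbhs_box nL.
exists d => // D Dd; exists (increment L z0) => z1 Dz1.
have [d1 d10 sub] := box_sub (Dd _ Dz1).
exists c, L, d1; split => // [z bz|z w bz Dz bw Dw]; first by apply: tr; exact: sub.
rewrite -(increment_add tr (box_center _ d0) (sub _ bz) (sub _ bw)).
by rewrite addrAC subrr add0r.
Qed.

(** The two potentials may come with different levels and lifts; on a smaller box the increments
    coincide, so one choice serves both. *)
Lemma potentials_agree D1 D2 F1 F2 z0 :
  potential D1 F1 -> potential D2 F2 -> D1 z0 -> D2 z0 ->
  exists c L d, potential_at D1 F1 z0 c L d /\ potential_at D2 F2 z0 c L d.
Proof.
move=> p1 p2 h1 h2; have [c [L [d P1]]] := p1 _ h1; have [c' [L' [d' P2]]] := p2 _ h2.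
have d0 : 0 < d by case: P1.
have d0' : 0 < d' by case: P2.
pose d1 := Num.min d d'.
have d10 : 0 < d1 <= d by rewrite /d1; mm; lra.
have d10' : 0 < d1 <= d' by rewrite /d1; mm; lra.
have Q1 := potential_at_le d10 P1; have Q2 := potential_at_le d10' P2.
have [c01 dd tr H] := Q1; have [c01' _ tr' H'] := Q2.
have [||d2 d20 inc] := increment_level dd _ _ tr tr'; [lra|lra|].
exists c, L, d2; split; first exact: potential_at_le Q1.
have [_ d2p trp Hp] := potential_at_le d20 Q2.
have [_ _ tr2 _] := potential_at_le d20 Q1.
by split => // z w bz Dz bw Dw; rewrite Hp // inc.
Qed.

(** A convex [D] is cut along [q = b]. On the common edge both potentials have the same local
    increments, so they differ there by a constant, which is added to [F2]. *)
Lemma glue_potentials (D D1 D2 : set (R * R)) (q : R * R -> R) (b : R) F1 F2 :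
  (forall z w t, D z -> D w -> 0 <= t <= 1 -> D (sp z w t)) ->
  (forall z w t, q (sp z w t) = q z + t * (q w - q z)) ->
  (forall z0 d z, box z0 d z -> q z0 - d < q z < q z0 + d) ->
  (forall z, D1 z <-> D z /\ q z <= b) -> (forall z, D2 z <-> D z /\ b <= q z) ->
  potential D1 F1 -> potential D2 F2 -> exists F, potential D F.
Proof.
move=> convD affq boxq D1E D2E p1 p2.
have edge z w : D1 z -> D2 z -> D1 w -> D2 w -> F1 z - F2 z = F1 w - F2 w.
  move=> z1 z2 w1 w2.
  have inE t : 0 <= t <= 1 -> D1 (sp z w t) /\ D2 (sp z w t).
    move: z1 z2 w1 w2; rewrite !D1E !D2E affq => -[Dz qz] [_ qz'] [Dw qw] [_ qw'] t01.
    have -> : q z = b by lra.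
    have -> : q w = b by lra.
    by rewrite subrr mulr0 addr0; split; split => //; exact: convD.
  have : F1 (sp z w 0) - F2 (sp z w 0) = F1 (sp z w 1) - F2 (sp z w 1).
    apply: (@interval_induction R (fun s t =>
      F1 (sp z w s) - F2 (sp z w s) = F1 (sp z w t) - F2 (sp z w t))) => //.
      by move=> s t r _ _ _ _ -> ->.
    move=> t t01; have [i1 i2] := inE t t01.
    have [c [L [d [[_ d0 _ H1] [_ _ _ H2]]]]] := potentials_agree p1 p2 i1 i2.
    have /nbhs_ballP [r /= r0 Hr] := cont_sp (box_nbhs (sp z w t) d0).
    exists r => // x y x0 xy y1 tx ty.
    have bx : box (sp z w t) d (sp z w x).
      by apply: Hr; rewrite /ball /= ltr_distlC; apply/andP; split; lra.
    have by_ : box (sp z w t) d (sp z w y).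
      by apply: Hr; rewrite /ball /= ltr_distlC; apply/andP; split; lra.
    have [|x1 x2] := inE x; first by lra.
    have [|y1' y2] := inE y; first by lra.
    have := H1 _ _ bx x1 by_ y1'; rewrite -(H2 _ _ bx x2 by_ y2) => /(canRL (subrK _)) ->.
    by rewrite [RHS](ACl (3*2*(1*4))) /= subrr addr0.
  rewrite /sp !mul0r !addr0 !mul1r -!surjective_pairing.
  by rewrite ![_ + (_ - _)]addrC !subrK -!surjective_pairing.
(* When the edge is empty any constant works, and 0 is taken. *)
have [K KE] : exists K, forall z, D1 z -> D2 z -> F1 z = F2 z + K.
  have [[z [z1 z2]]|nz] := pselect (exists z, D1 z /\ D2 z).
    exists (F1 z - F2 z) => w w1 w2; rewrite (edge _ _ z1 z2 w1 w2).
    by rewrite addrC subrK.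
  by exists 0 => z z1 z2; case: nz; exists z.
pose F z := if q z <= b then F1 z else F2 z + K.
have FE1 z : D1 z -> F z = F1 z by rewrite /F D1E => -[_ ->].
have FE2 z : D2 z -> F z = F2 z + K.
  by move=> z2; rewrite /F; case: ifP => // qz; apply: KE => //; have := z2; rewrite D1E D2E => -[].
have [s1 s2] : (forall z, D z -> q z <= b -> D1 z) /\ (forall z, D z -> b <= q z -> D2 z).
  by split => z Dz qz; [apply/D1E|apply/D2E].
(* Off the edge, shrinking the box to the distance of [q z0] from [b] leaves a single piece to
   consider. *)
exists F => z0 Dz0; case: (ltgtP (q z0) b) => qz0.
- have [c [L [d [c01 d0 tr H]]]] := p1 _ (s1 _ Dz0 (ltW qz0)).
  exists c, L, (Num.min d (b - q z0)).
  have dd : Num.min d (b - q z0) <= d by rewrite ge_min lexx.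
  have db : Num.min d (b - q z0) <= b - q z0 by rewrite ge_min lexx orbT.
  have in1 z : box z0 (Num.min d (b - q z0)) z -> D z -> D1 z.
    by move=> /boxq /andP [_ qz] Dz; apply: s1 => //; move: qz db; lra.
  split => //; first by rewrite lt_min d0 subr_gt0.
    by move=> z bz; apply: tr; exact: box_le bz.
  move=> z w bz Dz bw Dw; rewrite (FE1 _ (in1 _ bz Dz)) (FE1 _ (in1 _ bw Dw)).
  by apply: H; [exact: box_le bz|exact: in1|exact: box_le bw|exact: in1].
- have [c [L [d [c01 d0 tr H]]]] := p2 _ (s2 _ Dz0 (ltW qz0)).
  exists c, L, (Num.min d (q z0 - b)).
  have dd : Num.min d (q z0 - b) <= d by rewrite ge_min lexx.
  have db : Num.min d (q z0 - b) <= q z0 - b by rewrite ge_min lexx orbT.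
  have in2 z : box z0 (Num.min d (q z0 - b)) z -> D z -> D2 z.
    by move=> /boxq /andP [qz _] Dz; apply: s2 => //; move: qz db; lra.
  split => //; first by rewrite lt_min d0 subr_gt0.
    by move=> z bz; apply: tr; exact: box_le bz.
  move=> z w bz Dz bw Dw; rewrite (FE2 _ (in2 _ bz Dz)) (FE2 _ (in2 _ bw Dw)).
  rewrite opprD addrACA subrr addr0.
  by apply: H; [exact: box_le bz|exact: in2|exact: box_le bw|exact: in2].
have i1 : D1 z0 by apply: s1 => //; rewrite qz0.
have i2 : D2 z0 by apply: s2 => //; rewrite qz0.
have [c [L [d [[c01 d0 tr H1] [_ _ _ H2]]]]] := potentials_agree p1 p2 i1 i2.
exists c, L, d; split => //.
have G1 z w : box z0 d z -> D1 z -> box z0 d w -> D1 w -> F w - F z = increment L z w.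
  by move=> bz z1 bw w1; rewrite !FE1 //; exact: H1.
have G2 z w : box z0 d z -> D2 z -> box z0 d w -> D2 w -> F w - F z = increment L z w.
  by move=> bz z1 bw w1; rewrite !FE2 // opprD addrACA subrr addr0; exact: H2.
(* Two points on opposite sides are compared through the point of their segment that lies
   on the common edge. *)
have cross z w v : box z0 d z -> box z0 d w -> box z0 d v ->
    F v - F z = increment L z v -> F w - F v = increment L v w ->
    F w - F z = increment L z w.
  move=> bz bw bv e1 e2; rewrite -(increment_add tr bz bv bw) -e1 -e2.
  by rewrite [RHS]addrC addrA subrK.
(* The crossing parameter [t] solves the affine equation [q = b] along the segment. *)
have mid z w : box z0 d z -> D z -> box z0 d w -> D w -> q z <= b <= q w \/ q w <= b <= q z ->
    q z != q w -> exists v, [/\ box z0 d v, D1 v & D2 v].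
  move=> bz Dz bw Dw qzw ne; pose t := (b - q z) / (q w - q z).
  have nz : q w - q z != 0 by rewrite subr_eq0 eq_sym.
  have t01 : 0 <= t <= 1.
    case: qzw => qq.
      have p : 0 < q w - q z by rewrite lt_neqAle eq_sym nz; lra.
      by rewrite /t divr_ge0 ?ler_pdivrMr ?mul1r //=; lra.
    have p : 0 < - (q w - q z) by rewrite lt_neqAle eq_sym oppr_eq0 nz; lra.
    rewrite /t -[q w - q z]opprK invrN mulrN -mulNr.
    by rewrite divr_ge0 ?ler_pdivrMr ?mul1r //=; lra.
  have qv : q (sp z w t) = b by rewrite affq /t divfK // addrC subrK.
  have Dv : D (sp z w t) by exact: convD.
  by exists (sp z w t); split; [exact: box_sp|apply: s1; rewrite ?qv|apply: s2; rewrite ?qv].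
move=> z w bz Dz bw Dw; case: (leP (q z) b) => qz; case: (leP (q w) b) => qw.
- by apply: G1 => //; exact: s1.
- have [|||||| v [bv v1 v2]] := mid z w => //; first by left; rewrite qz ltW.
    by rewrite lt_eqF //; exact: le_lt_trans qw.
  apply: (cross _ _ v) => //; first by apply: G1 => //; exact: s1.
  by apply: G2 => //; apply: s2 => //; exact: ltW.
- have [|||||| v [bv v1 v2]] := mid z w => //; first by right; rewrite qw ltW.
    by rewrite gt_eqF //; exact: le_lt_trans qz.
  apply: (cross _ _ v) => //; first by apply: G2 => //; apply: s2 => //; exact: ltW.
  by apply: G1 => //; exact: s1.
- by apply: G2 => //; apply: s2 => //; exact: ltW.
Qed.

Definition rect (x y x' y' : R) : set (R * R) :=
  [set z | x <= z.1 <= y /\ x' <= z.2 <= y'].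

Lemma rect_conv x y x' y' z w t : rect x y x' y' z -> rect x y x' y' w ->
  0 <= t <= 1 -> rect x y x' y' (sp z w t).
Proof. by move=> [/= ? ?] [/= ? ?] t01; split => /=; nra. Qed.

Lemma glue_horizontal x y v x' y' : x <= y -> y <= v ->
  (exists F, potential (rect x y x' y') F) -> (exists F, potential (rect y v x' y') F) ->
  exists F, potential (rect x v x' y') F.
Proof.
move=> xy yv [F1 p1] [F2 p2].
apply: (glue_potentials (q := fst) (b := y) _ _ _ _ _ p1 p2) => //.
- by move=> z w t; exact: rect_conv.
- by move=> z0 d z [-> ->].
- by move=> z; split; rewrite /rect /=; [move=> [? ?]|move=> [[? ?] ?]]; do ?split; lra.
- by move=> z; split; rewrite /rect /=; [move=> [? ?]|move=> [[? ?] ?]]; do ?split; lra.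
Qed.

Lemma glue_vertical x y x' y' v' : x' <= y' -> y' <= v' ->
  (exists F, potential (rect x y x' y') F) -> (exists F, potential (rect x y y' v') F) ->
  exists F, potential (rect x y x' v') F.
Proof.
move=> xy yv [F1 p1] [F2 p2].
apply: (glue_potentials (q := snd) (b := y') _ _ _ _ _ p1 p2) => //.
- by move=> z w t; exact: rect_conv.
- by move=> z0 d z [_ _ -> ->].
- by move=> z; split; rewrite /rect /=; [move=> [? ?]|move=> [[? ?] ?]]; do ?split; lra.
- by move=> z; split; rewrite /rect /=; [move=> [? ?]|move=> [[? ?] ?]]; do ?split; lra.
Qed.

(** Boxes centred at height [s] are glued from left to right, keeping the smaller of the two
    heights; [square_potential] then stacks the strips. *)
Lemma strip_potential s : exists2 d, 0 < d & forall x' y', s - d < x' -> y' < s + d ->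
  exists F, potential (rect 0 1 x' y') F.
Proof.
apply: (@interval_induction R (fun x y => exists2 d, 0 < d & forall x' y',
  s - d < x' -> y' < s + d -> exists F, potential (rect x y x' y') F)); first exact: ler01.
  move=> x y z _ xy yz _ [d1 d10 H1] [d2 d20 H2].
  exists (Num.min d1 d2); first by mm; lra.
  move=> x' y' sx sy; apply: (glue_horizontal xy yz).
    by apply: H1; move: sx sy; mm; lra.
  by apply: H2; move: sx sy; mm; lra.
move=> t _; have [d d0 H] := local_potential (t, s).
exists d => // x y _ _ _ tx ty; exists d => // x' y' sx sy.
by apply: H => z [/= ? ?]; split => /=; lra.
Qed.

Lemma square_potential : exists F, potential (rect 0 1 0 1) F.
Proof.
apply: (@interval_induction R (fun x y => exists F, potential (rect 0 1 x y) F)).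
- exact: ler01.
- by move=> x y z _ xy yz _; exact: glue_vertical.
- move=> s _; have [d d0 H] := strip_potential s.
  by exists d => // x y _ _ _ sx sy; exact: H.
Qed.

End Potentials.

(** * Potentials along the boundary of the square *)

Section PotentialBoundary.
Context {R : realType} {X : topologicalType} {e : X}.
Local Notation James := (James e).
Variables (u : X -> R) (k : X -> X).
Hypotheses (cu : continuous u) (ue : u e = 0) (ck : continuous k)
  (ku : forall x, u x < 1 -> k x = e).
Context {A : zmodType} (phi : (Delta1 R -> X) -> A) (co : cocycle phi).
Variables (f : R * R -> James) (F : R * R -> A).
Hypothesis pF : potential u k phi f (@rect R 0 1 0 1) F.

(** The empty word has no letters, so the local lifts along this side are empty and all increments
    vanish. *)
Lemma potential_side x : 0 <= x <= 1 -> (forall s, f (x, s) = jsigma e e) ->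
  F (x, 0) = F (x, 1).
Proof.
move=> x01 fE.
apply: (@interval_induction R (fun s t => F (x, s) = F (x, t))) => //.
  by move=> r s t _ _ _ _ -> ->.
move=> t t01; have [|c [L [d [c01 d0 tr H]]]] := pF (_ : rect 0 1 0 1 (x, t)); first by split.
exists d => // r s r0 rs s1 tr' ts.
have br : box (x, t) d (x, r) by split => /=; lra.
have bs : box (x, t) d (x, s) by split => /=; lra.
have := H _ _ br _ bs _; rewrite (_ : L = [::]); last first.
  have [_ + _] := tr _ br; rewrite fE base_jl /big_letters word_jl /=.
  by case: (L).
rewrite /increment big_nil => /(_ _ _)/eqP; rewrite subr_eq0 => E.
by apply/esym/eqP/E; split => /=; lra.
Qed.

(** On words of at most one letter a local lift is either [a] itself or empty; in the second case
    [a] stays below level 1 and [k] makes it constant. *)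
Lemma potential_edge (a : Delta1 R -> X) y : 0 <= y <= 1 -> continuous a ->
  (forall s, f (s, y) = jsigma e (a (D1 s))) ->
  F (1, y) - F (0, y) = phi (fun t => k (a t)).
Proof.
move=> y01 ca fE.
pose p (s : R) := k (a (D1 s)).
have cp : continuous p by rewrite /p; cont.
have -> : (fun t => k (a t)) = seg p 0 1.
  by apply/funext => t; rewrite /seg /p subr0 mulr1 add0r D1K.
apply: (@interval_induction R (fun s t => F (t, y) - F (s, y) = phi (seg p s t))) => //.
  move=> r s t _ _ _ _ e1 e2.
  have := @cocycle_segx R X A phi co (fun z => p z.1) (r, 0) (s, 0) (t, 0) _.
  have cp1 : continuous (fun z : R * R => p z.1) by cont.
  move=> /(_ (fun a b _ _ _ => cp1 _)); rewrite -/(seg p r s) -/(seg p s t) -/(seg p r t) => <-.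
  by rewrite -e1 -e2 [RHS]addrC addrA subrK.
move=> t t01; have [|c [L [d [c01 d0 tr H]]]] := pF (_ : rect 0 1 0 1 (t, y)); first by split.
exists d => // r s r0 rs s1 tr' ts.
have bx v : t - d < v -> v < t + d -> box (t, y) d (v, y) by split => /=; lra.
rewrite (H (r, y) (s, y)); [|exact: bx (le_lt_trans rs ts)| |exact: bx (lt_le_trans tr' rs) ts|]; last 2 first.
- by split => /=; lra.
- by split => /=; lra.
have LE v : t - d < v -> v < t + d -> [seq l (v, y) | l <- L] = [seq x <- [:: a (D1 v)] | c < u x].
  move=> v1 v2; have [_ <- _] := tr _ (bx v v1 v2).
  by rewrite fE jsigma_jl big_letters_jl //; lra.
have vE (v : Delta1 R) : t - d < r + sval v * (s - r) < t + d.
  by have := sval01 v; nra.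
case: L {tr H} LE => [|l [|l' L]] LE.
- rewrite /increment big_nil (_ : seg p r s = fun=> e) ?(cocycle_cst co) //.
  apply/funext => v; apply: ku; have /andP [v1 v2] := vE v.
  have := LE _ v1 v2; rewrite /=; case: (ltP c) => // uc _.
  by apply: le_lt_trans uc _; lra.
- rewrite /increment big_seq1; congr phi; apply/funext => v; rewrite /seg /p; congr k.
  have /andP [v1 v2] := vE v; have := LE _ v1 v2; rewrite /sp /= subrr mulr0 addr0.
  by case: ifP => // _ [].
- have tl : t - d < t by lra.
  have tu : t < t + d by lra.
  by have := LE t tl tu; rewrite /=; case: ifP.
Qed.
End PotentialBoundary.

(** * The kernel of [sigma_sharp] *)

Section Kernel.
Context {R : realType} {X : topologicalType} {e : X}.
Variables (u : X -> R) (h : X -> R -> X).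
Hypotheses (cu : continuous u) (ue : u e = 0)
  (ch : continuous (fun p : X * R => h p.1 p.2))
  (h0 : forall x, h x 0 = x) (he : forall t, h e t = e)
  (h1 : forall x, u x < 1 -> h x 1 = e).
Context {A : zmodType} (phi : (Delta1 R -> X) -> A) (co : cocycle phi).

(** A potential for the homotopy is compared at the four corners: bottom and top give the pushed
    values of [phi], and the sides give 0. *)
Lemma cocycle_sigma (a b : Delta1 R -> X) (Pa : is_path e e a) (Pb : is_path e e b) :
  sigma_sharp (pcl Pa : pi1 R e) = sigma_sharp (pcl Pb : pi1 R e) -> phi a = phi b.
Proof.
rewrite !sigma_pcl => /pcl_eq [H [cH H0 H1 Hs]].
pose f (z : R * R) := H (D1 z.1, D1 z.2).
have cf : continuous f by rewrite /f; cont.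
have ck : continuous (fun x => h x 1).
  have cz : continuous (fun z : X => (z, 1 : R)) by cont.
  exact: (contcomp cz ch).
have [F pF] := square_potential cu ue ck h1 co cf.
(* Pushing a loop by [h] is a homotopy relative to [e], so [phi] does not change. *)
have hE g : is_path e e g -> phi (fun t => h (g t) 1) = phi g.
  move=> [cg g0 g1]; symmetry; apply: (cocycle_htpy co (x := e) (y := e)).
  exists (fun p => h (g p.1) (sval p.2)); split => [|t|t|s]; rewrite ?h0 ?g0 ?g1 ?he //.
  have cq : continuous (fun q : Delta1 R * Delta1 R => (g q.1, sval q.2)) by cont.
  exact: (contcomp cq ch).
have [ca _ _] := Pa; have [cb _ _] := Pb.
have Ea := potential_edge ue ck h1 co pF (y := 0) (a := a).
have Eb := potential_edge ue ck h1 co pF (y := 1) (a := b).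
rewrite -(hE a) // -(hE b) // -Ea ?lexx ?ler01 //; last by move=> s; rewrite /f /= (@D1_le0 R 0) // H0.
rewrite -Eb ?lexx ?ler01 //; last by move=> s; rewrite /f /= (@D1_ge1 R 1) // H1.
rewrite (potential_side pF (x := 0)) ?lexx ?ler01 //; last first.
  by move=> s; rewrite /f /= (@D1_le0 R 0) // (Hs _).1.
rewrite (potential_side pF (x := 1)) ?lexx ?ler01 //.
by move=> s; rewrite /f /= (@D1_ge1 R 1) // (Hs _).2.
Qed.
End Kernel.

(** * The isomorphism induced by equal kernels *)

Theorem mainTheorem18 (R : realType) (X : topologicalType) (e : X) :
  path_connected R X -> hausdorff_space X -> cofibration_pt R e ->
  exists rho : H1 R X -> pi1 R (jsigma e e),
    [/\ (forall a b, rho (H1_add a b) = pi1_mul (rho a) (rho b)),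
        (forall a : pi1 R e, rho (hurewicz a) = sigma_sharp a),
        (forall rho' : H1 R X -> pi1 R (jsigma e e),
            (forall a b, rho' (H1_add a b) = pi1_mul (rho' a) (rho' b)) ->
            (forall a : pi1 R e, rho' (hurewicz a) = sigma_sharp a) ->
            rho' = rho)
      & bijective rho].
Proof.
move=> pc _ cof.
have [u [h [cu ue ch [h0 he h1]]]] := cofibration_retraction cof.
(* The path chosen to [e] is made constant, so that letterwise paths respect reduction of words. *)
have [gam gamP game] : exists2 gam : X -> Delta1 R -> X,
    forall x, is_path e x (gam x) & forall t, gam e t = e.
  have /choice [gam gamP] : forall x, exists f : Delta1 R -> X, is_path e x f.
    by move=> x; exact: (pc e x).
  exists (fun x => if pselect (x = e) then fun=> e else gam x) => [x|t].
    by case: pselect => [ex|_] //=; rewrite {1}ex; exact: cst_path.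
  by case: pselect.
have [A [phi [co univ]]] := @universal_cocycle R X.
have [B [v [psi [vinj copsi psiE]]]] := sigma_cocycle cu ue ch h0 he h1 gamP game.
have hs : forall a b : pi1 R e, hurewicz a = hurewicz b <-> sigma_sharp a = sigma_sharp b.
  move=> a b; have [f [Pf ->]] := homP a; have [g [Pg ->]] := homP b; split => [hab|sab].
    apply: vinj; rewrite -!psiE -(csum1 psi f) -(csum1 psi g).
    apply: homologous_csum => //; apply/univ; rewrite !csum1.
    by rewrite -(H1_val_hurewicz_pcl co univ Pf) -(H1_val_hurewicz_pcl co univ Pg) hab.
  apply: (H1_val_inj univ); rewrite !(H1_val_hurewicz_pcl co univ).
  exact: (cocycle_sigma cu ue ch h0 he h1 co sab).
have hsurj := hurewicz_surj co univ e pc.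
have /choice [lift liftE] := hsurj.
(* By [hs] the value does not depend on the chosen preimage under [hurewicz]; uniqueness comes from
   the surjectivity of [hurewicz]. *)
pose rho (x : H1 R X) : pi1 R (jsigma e e) := sigma_sharp (lift x).
have rhoE a : rho (hurewicz a) = sigma_sharp a by apply/hs.
exists rho; split => //.
- move=> x y; rewrite -{1}(liftE x) -{1}(liftE y) -(hurewicz_mul co univ) rhoE.
  by rewrite !pi1_mulE sigma_mul.
- move=> rho' _ rho'E; apply/funext => x.
  by rewrite -(liftE x) rhoE rho'E.
- have /choice [g gE] : forall y : pi1 R (jsigma e e), exists x, rho x = y.
    move=> y; have [b <-] := sigma_surj cu ue ch h0 he h1 gamP game y.
    by exists (hurewicz b).
  have rho_inj : injective rho by move=> x y /hs; rewrite !liftE.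
  by exists g => // x; apply: rho_inj; rewrite gE.
Qed.
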